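(* Let $G$ be a finitely presented sofic BFS-group with decidable word problem for which the Atiyah conjecture holds. Then there is an algorithm which solves Kernel-over-$\mathbb Z[G]$, i.e. an algorithm which, given as input a matrix $M\in M_k(\mathbb Z[G])$ for some $k$, always halts and correctly decides whether $\ker M=\{0\}$, where $M$ is considered as an operator $l^2(G)^k\to l^2(G)^k$.
   Context: A BFS-group is a group for which there is a bound on the sizes of its finite subgroups. $\mathbb Z[G]$ acts on the Hilbert space $l^2(G)$ (orthonormal basis $(\zeta_g)_{g\in G}$) by $g\cdot\zeta_h=\zeta_{gh}$, and $M_k(\mathbb Z[G])$ acts on $l^2(G)^k$. For $M\in M_k(\mathbb Z[G])$ with $P$ the orthogonal projection onto $\ker M\subset l^2(G)^k$, $\dim_{\mathrm{vN}}\ker M=\sum_{i=1}^k\langle P\zeta_e^{(i)},\zeta_e^{(i)}\rangle$, where $\zeta_e^{(i)}$ is $\zeta_e$ placed in the $i$-th coordinate. Elements of $\mathbb Z[G]$ are given to the algorithm as finite formal integer combinations of words in a fixed finite generating set of $G$. Atiyah conjecture for a BFS-group $G$: let $\mathcal C(G)$ be the set of all $l^2$-Betti numbers of finite CW-complexes with fundamental group $G$; equivalently, the set of all numbers $\dim_{\mathrm{vN}}\ker M$ for $M\in M_k(\mathbb Z[G])$, $k\ge1$. The Atiyah conjecture holds for $G$ if there is a positive integer $k(G)$ such that $\mathcal C(G)=\{0,\frac1{k(G)},\frac2{k(G)},\ldots\}$. Sofic groups: let $G$ be generated by a finite symmetric sequence $(g_1,\ldots,g_n)$ (each $g\in G$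 appears as many times as $g^{-1}$). The Cayley diagram $\mathcal C(G,g_i)$ has vertex set $G$ and an oriented edge labelled $g_i$ from $a$ to $b$ whenever $ag_i=b$. Consider finite oriented graphs $K$ edge-labelled by the $g_i$ such that (1) at every vertex the in- and out-degrees are at most $n$ and each symbol $g_i$ appears at most once as an out-label and at most once as an in-label; (2) for each $g_i$, the number of edges labelled $g_i$ from $v$ to $w$ equals the number of such edges from $w$ to $v$. For $\varepsilon\ge0$, $R>0$, such a $K$ is an $(\varepsilon,R)$-sofic approximation of $G$ if at least $(1-\varepsilon)|V(K)|$ vertices $v$ have the property that the ball $B_K(v,R)$ is isomorphic, as an edge-labelled graph, to $B_{\mathcal C(G,g_i)}(e,R)$. The finitely generated group $G$ is sofic if for all $\varepsilon>0$ and $R>0$ it has an $(\varepsilon,R)$-sofic approximation (this does not depend on the generating sequence); a general countable group is sofic if all its finitely generated subgroups are. (Here, in condition (2), ''such edges from $w$ to $v$'' is to be read as the edges carrying the label corresponding to $g_i^{-1}$, which is the condition satisfied by Cayley diagrams.) *)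

(* Defs.v *)
From HB Require Import structures.
From mathcomp Require Import all_boot all_order all_algebra finmap.
From mathcomp Require Import boolp classical_sets functions reals ereal esum.
From mathcomp Require Import complex.

Set Implicit Arguments.
Unset Strict Implicit.
Unset Printing Implicit Defensive.

Import Order.TTheory GRing.Theory Num.Theory.

Local Open Scope classical_set_scope.
Local Open Scope nat_scope.

(* Kleene's mu-recursive functions.  Arities are not tracked: a missing
   argument reads as 0. *)
Inductive murec : Type :=
| MZero
| MSucc
| MProj of nat
| MComp of murec & seq murec
| MPrec of murec & murec
| MMu of murec.

(* [mueval f v y]: the computation of [f] on the argument list [v] halts with
   value [y].  [MPrec g h] is f(0, v) = g(v), f(m+1, v) = h(m, f(m, v), v);
   [MMu g] is the least y with g(y, v) = 0, all g(m, v) with m < y being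
   defined and nonzero. *)
Fixpoint mueval (f : murec) (v : seq nat) (y : nat) {struct f} : Prop :=
  match f with
  | MZero => y = 0
  | MSucc => y = (nth 0 v 0).+1
  | MProj i => y = nth 0 v i
  | MComp g hs =>
      exists2 ws : seq nat,
        (fix all_eval (hs : seq murec) (ws : seq nat) {struct hs} : Prop :=
           match hs, ws with
           | [::], [::] => True
           | h :: hs', w :: ws' => mueval h v w /\ all_eval hs' ws'
           | _, _ => False
           end) hs ws
        & mueval g ws y
  | MPrec g h =>
      (fix iter_eval (m : nat) (z : nat) {struct m} : Prop :=
         match m with
         | 0 => mueval g (behead v) z
         | m'.+1 =>
             exists2 r, iter_eval m' r & mueval h (m' :: r :: behead v) z
         end) (nth 0 v 0) y
  | MMu g =>
      mueval g (y :: v) 0 /\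
      forall m, m < y -> exists r, mueval g (m :: v) r.+1
  end.

(* On input [x] the algorithm halts, with output 1 if [P] holds and 0 if not. *)
Definition decides_at (f : murec) (x : nat) (P : Prop) : Prop :=
  exists b : bool, mueval f [:: x] b /\ (b <-> P).

(* Cantor's pairing bijection. *)
Definition cpair (a b : nat) : nat := 'C((a + b).+1, 2) + b.

Definition code_seq (T : Type) (c : T -> nat) (s : seq T) : nat :=
  foldr (fun x r => (cpair (c x) r).+1) 0 s.

Definition code_int (z : int) : nat :=
  match z with Posz m => m.*2 | Negz m => m.*2.+1 end.

(* [(i, false)] stands for the i-th generator, [(i, true)] for its inverse. *)
Definition letter (n : nat) : Type := ('I_n * bool)%type.
Definition word (n : nat) : Type := seq ('I_n * bool).

Definition linv n (l : letter n) : letter n := (l.1, ~~ l.2).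

Definition code_letter n (l : letter n) : nat := (l.1 : nat).*2 + l.2.
Definition code_word n (w : word n) : nat := code_seq (@code_letter n) w.

Definition weval (G : groupType) n (gens : 'I_n -> G) (w : word n) : G :=
  foldr (fun l x => ((if l.2 then (gens l.1)^-1 else gens l.1) * x)%g) 1%g w.

Definition generates (G : groupType) n (gens : 'I_n -> G) : Prop :=
  forall x : G, exists w : word n, weval gens w = x.

(* Equality of words in the group < 'I_n | rels >. *)
Inductive pres_eq n (rels : seq (word n)) : word n -> word n -> Prop :=
| pres_refl w : pres_eq rels w w
| pres_sym w w' : pres_eq rels w w' -> pres_eq rels w' w
| pres_trans w w' w'' :
    pres_eq rels w w' -> pres_eq rels w' w'' -> pres_eq rels w w''
| pres_cancel u v (l : letter n) :
    pres_eq rels (u ++ [:: l; linv l] ++ v) (u ++ v)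
| pres_rel u v r : r \in rels -> pres_eq rels (u ++ r ++ v) (u ++ v).

Definition finitely_presented (G : groupType) : Prop :=
  exists n (gens : 'I_n -> G) (rels : seq (word n)),
    generates gens /\
    forall w, weval gens w = 1%g <-> pres_eq rels w [::].

(* Whether this holds does not depend on the generating family. *)
Definition decidable_word_problem (G : groupType) : Prop :=
  exists n (gens : 'I_n -> G),
    generates gens /\
    exists f : murec, forall w : word n,
      decides_at f (code_word w) (weval gens w = 1%g).

(* Finite subgroups are given by their duplicate-free lists of elements. *)
Definition BFS_group (G : groupType) : Prop :=
  exists N : nat, forall H : seq G,
    uniq H -> group_closed (mem H) -> size H <= N.

(* A graph with edges labelled by 'I_n is a ternary relation: [e a i b] says
   that there is an edge labelled i from a to b.  Parallel edges with the same
   label are ruled out by the degree conditions in [admissible], and do not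
   occur in Cayley diagrams. *)
Section LabelledGraphs.
Variable n : nat.

Fixpoint gball (T : Type) (e : T -> 'I_n -> T -> bool) (v : T) (r : nat) :
    set T :=
  match r with
  | 0 => [set v]
  | r'.+1 => [set w | gball e v r' w \/
               exists2 u, gball e v r' u & exists i, e u i w || e w i u]
  end.

(* The isomorphism is between the induced subgraphs on A1 and A2; it is not
   required to respect centres of balls. *)
Definition lgraph_iso (T1 T2 : Type)
    (e1 : T1 -> 'I_n -> T1 -> bool) (A1 : set T1)
    (e2 : T2 -> 'I_n -> T2 -> bool) (A2 : set T2) : Prop :=
  exists phi : T1 -> T2, set_bij A1 A2 phi /\
    forall u i w, A1 u -> A1 w -> e1 u i w = e2 (phi u) i (phi w).

Definition cayley (G : groupType) (g : 'I_n -> G) (a : G) (i : 'I_n) (b : G) :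
    bool := (a * g i)%g == b.

Definition symmetric_family (G : groupType) (g : 'I_n -> G) : Prop :=
  forall x : G, #|[pred i | g i == x]| = #|[pred i | g i == x^-1%g]|.

Definition admissible (G : groupType) (g : 'I_n -> G) (V : finType)
    (e : V -> 'I_n -> V -> bool) : Prop :=
  (forall v, [/\ #|[pred p : 'I_n * V | e v p.1 p.2]| <= n,
                 #|[pred p : 'I_n * V | e p.2 p.1 v]| <= n &
                 forall i, #|[pred w | e v i w]| <= 1 /\
                           #|[pred w | e w i v]| <= 1]) /\
  (* An edge is counted when its symbol j represents the group element g_i,
     resp. its inverse: repetitions in the sequence g are allowed. *)
  (forall i v w, #|[pred j | (g j == g i) && e v j w]| =
                 #|[pred j | (g j == (g i)^-1%g) && e w j v]|).

Definition sofic_approximation (R : realType) (G : groupType) (g : 'I_n -> G)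
    (eps : R) (r : nat) (V : finType) (e : V -> 'I_n -> V -> bool) : Prop :=
  admissible g e /\
  ((1 - eps) * #|V|%:R <=
    #|[pred v : V | `[< lgraph_iso e (gball e v r)
                          (cayley g) (gball (cayley g) 1%g r) >]]|%:R)%R.

End LabelledGraphs.

(* Soficity of a finitely generated group.  Approximations are nonempty graphs:
   the empty graph would satisfy the counting condition for every group.  Balls
   only depend on the integer part of their radius. *)
Definition sofic (R : realType) (G : groupType) : Prop :=
  exists n (g : 'I_n -> G), [/\ symmetric_family g, generates g &
    forall (eps : R) (r : nat), (0 < eps)%R -> 0 < r ->
      exists (V : finType) (e : V -> 'I_n -> V -> bool),
        0 < #|V| /\ sofic_approximation g eps r e].

Local Open Scope ring_scope.
Local Open Scope complex_scope.

Section L2.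
Variables (R : realType) (G : groupType).

(* Only meaningful for absolutely summable families. *)
Definition rsum (f : G -> R) : R :=
  fine (\esum_(g in [set: G]) (Num.max (f g) 0)%:E) -
  fine (\esum_(g in [set: G]) (Num.max (- f g) 0)%:E).

Definition csum (f : G -> R[i]) : R[i] :=
  rsum (fun g => complex.Re (f g)) +i* rsum (fun g => complex.Im (f g)).

Definition l2 k (x : 'I_k -> G -> R[i]) : Prop :=
  forall i, (\esum_(g in [set: G])
    (complex.Re (x i g) ^+ 2 + complex.Im (x i g) ^+ 2)%:E < +oo)%E.

Definition inner k (x y : 'I_k -> G -> R[i]) : R[i] :=
  \sum_i csum (fun g => x i g * (y i g)^*).

Definition zeta_e k (i : 'I_k) : 'I_k -> G -> R[i] :=
  fun j g => ((j == i) && (g == 1%g))%:R.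

Definition ZG : Type := {fsfun G -> int with 0}.

(* g . zeta_h = zeta_(g h), i.e. (g . x)(h) = x (g^-1 h). *)
Definition mxact k (M : 'M[ZG]_k) (x : 'I_k -> G -> R[i]) :
    'I_k -> G -> R[i] :=
  fun i h => \sum_j \sum_(g <- finsupp (M i j))
    (M i j g)%:~R * x j (g^-1 * h)%g.

Definition in_ker k (M : 'M[ZG]_k) (x : 'I_k -> G -> R[i]) : Prop :=
  l2 x /\ forall i h, mxact M x i h = 0.

Definition ker_trivial k (M : 'M[ZG]_k) : Prop :=
  forall x, in_ker M x -> forall i h, x i h = 0.

Definition orth_projection k (K : ('I_k -> G -> R[i]) -> Prop)
    (P : ('I_k -> G -> R[i]) -> 'I_k -> G -> R[i]) : Prop :=
  forall x, l2 x -> K (P x) /\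
    forall y, K y -> inner (fun i h => x i h - P x i h) y = 0.

(* P is unique on l^2(G)^k, and exists because the kernel is closed. *)
Definition dim_vN_ker k (M : 'M[ZG]_k) (d : R) : Prop :=
  exists P, orth_projection (in_ker M) P /\
    \sum_i inner (P (zeta_e i)) (zeta_e i) = d%:C.

(* The l^2-Betti numbers of finite CW-complexes with fundamental group G, in
   their algebraic description as dimensions of kernels over Z[G]. *)
Definition l2_betti_numbers : set R :=
  [set d | exists (k : nat) (M : 'M[ZG]_k), (0 < k)%N /\ dim_vN_ker M d].

Definition Atiyah_conjecture : Prop :=
  exists kG : nat, (0 < kG)%N /\
    l2_betti_numbers = [set j%:R / kG%:R | j in [set: nat]].

End L2.

Definition formal (n : nat) : Type := seq (int * word n).

Definition formal_eval (G : groupType) n (gens : 'I_n -> G) (a : formal n) :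
    ZG G :=
  [fsfun x in seq_fset tt [seq weval gens t.2 | t <- a] =>
     \sum_(t <- a | weval gens t.2 == x) t.1 | 0].

Definition code_formal n (a : formal n) : nat :=
  code_seq (fun t : int * word n => cpair (code_int t.1) (code_word t.2)) a.

Definition code_matrix n k (M : 'M[formal n]_k) : nat :=
  code_seq (fun i => code_seq (fun j => code_formal (M i j)) (enum 'I_k))
    (enum 'I_k).

(* The algorithm may depend on G and gens, but not on the size k. *)
Definition kernel_over_ZG_solvable (R : realType) (G : groupType) : Prop :=
  forall n (gens : 'I_n -> G), generates gens ->
    exists f : murec, forall (k : nat) (M : 'M[formal n]_k), (0 < k)%N ->
      decides_at f (code_matrix M)
        (ker_trivial R (map_mx (formal_eval gens) M)).

(* Main.v *)
Require Import Defs.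
From mathcomp Require Import all_boot all_order all_algebra finmap.
From mathcomp Require Import boolp classical_sets functions cardinality fsbigop.
From mathcomp Require Import reals ereal esum topology normedtype sequences.
From mathcomp Require Import complex.
From mathcomp Require Import zify ring lra.

Set Implicit Arguments.
Unset Strict Implicit.
Unset Printing Implicit Defensive.

(** Let C >= 2 bound the norm of M^* M and put S = 1 - M^* M / C, so that
    0 <= S <= 1.  The moments a_m = tr S^m decrease to the trace of the
    orthogonal projection onto ker M, i.e. to d = dim ker M, and d = 0 iff
    ker M = 0.  By the Atiyah conjecture, d < 1/k(G) forces d = 0.

    Soficity makes the convergence effective.  A finite partial action of G
    turns M into an integer matrix N; the product of the nonzero eigenvalues of
    N^T N is a nonzero integer, so at most a proportion 1/q of the eigenvalues
    lies in (0, C^-q].  For m >= q C^(q+1), each of the larger eigenvalues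
    contributes at most 1/(q+1) to the trace of (1 - N^T N / C)^m.  Hence
    a_m <= d + k/q + k/(q+1) for a k x k matrix M.  With q = 2 k k(G) + 1 the
    kernel is trivial iff k(G) a_m < 1, and C^m a_m is an integer that can be
    computed from M by means of the word problem. *)

Import Order.TTheory GRing.Theory Num.Theory.
Import numFieldNormedType.Exports.
Local Open Scope classical_set_scope.
Local Open Scope nat_scope.

(** * Mu-recursive functions on encoded data *)

(** The dimension [d] is a limit, whereas a sofic graph controls only finitely many moments and has
    to be chosen after them. So [a_m] is not compared with the kernel of a finite model: for each
    [p] a graph is chosen that approximates both [a_m] and [a_p], the eigenvalue count on it gives
    [a_m <= a_p + k/q + k/(q+1)] with an error independent of [p] and of the graph, and then [p]
    tends to infinity on the group side. No convergence of spectral measures enters. To speak of the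
    same power of [C - M^* M] in the algorithm, on l^2 and on a graph, matrices are lists of terms
    carrying unreduced words. Products are concatenations and adjoints are formal inverses, so one
    list can be read as codes, as an operator on real l^2 functions, or as an integer matrix. For
    the last reading an action by partial bijections suffices, and the group enters the trace only
    through the words that evaluate to 1. The l^1 norm of the coefficients bounds both operator
    readings, hence the constant [snorm A ^ 2 + 2]. *)

Definition recursive (F : seq nat -> nat) : Prop :=
  exists f, forall v, mueval f v (F v).

Lemma eq_recursive F F' : F =1 F' -> recursive F -> recursive F'.
Proof. by move=> eqF [f fP]; exists f => v; rewrite -eqF. Qed.

Lemma recursive_proj i : recursive (nth 0 ^~ i).
Proof. by exists (MProj i). Qed.

Lemma recursive_succ F : recursive F -> recursive (fun v => (F v).+1).
Proof.
by move=> [f fP]; exists (MComp MSucc [:: f]) => v /=; exists [:: F v].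
Qed.

Lemma recursive_const c : recursive (fun=> c).
Proof. by elim: c => [|c IHc]; [exists MZero | exact: recursive_succ]. Qed.

Lemma recursive_comp1 (F : nat -> nat) G :
  recursive (fun v => F (nth 0 v 0)) -> recursive G ->
    recursive (fun v => F (G v)).
Proof.
move=> [f fP] [g gP]; exists (MComp f [:: g]) => v /=.
by exists [:: G v] => //; apply: (fP [:: _]).
Qed.

Lemma recursive_comp2 (F : nat -> nat -> nat) G H :
  recursive (fun v => F (nth 0 v 0) (nth 0 v 1)) -> recursive G ->
    recursive H ->
  recursive (fun v => F (G v) (H v)).
Proof.
move=> [f fP] [g gP] [h hP]; exists (MComp f [:: g; h]) => v /=.
by exists [:: G v; H v] => //; apply: (fP [:: _; _]).
Qed.

Lemma recursive_prec (G : seq nat -> nat) (H : nat -> nat -> seq nat -> nat) :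
  recursive G -> recursive (fun v =>
    H (nth 0 v 0) (nth 0 v 1) (behead (behead v))) ->
  recursive (fun v => nat_rect (fun=> nat) (G (behead v)) (fun m r =>
    H m r (behead v))
                        (nth 0 v 0)).
Proof.
move=> [g gP] [h hP]; exists (MPrec g h) => v /=.
elim: (nth 0 v 0) => [|m IHm] //=;
  exists (nat_rect (fun=> nat) (G (behead v)) (fun m r =>
    H m r (behead v)) m) => //.
Qed.

Lemma recursive_add F G : recursive F -> recursive G ->
  recursive (fun v => F v + G v).
Proof.
apply: recursive_comp2.
apply: eq_recursive (@recursive_prec (nth 0 ^~ 0) (fun m r v => r.+1) _ _).
- by move=> v; rewrite nth_behead; elim: (nth 0 v 0) => //= m ->.
- exact: recursive_proj.
- exact: recursive_succ (recursive_proj 1).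
Qed.

Lemma recursive_pred F : recursive F -> recursive (fun v => (F v).-1).
Proof.
apply: recursive_comp1.
apply: eq_recursive (@recursive_prec (fun=> 0) (fun m r v => m) _ _).
- by move=> v; case: (nth 0 v 0).
- exact: recursive_const.
- exact: recursive_proj.
Qed.

Lemma recursive_sub F G : recursive F -> recursive G ->
  recursive (fun v => F v - G v).
Proof.
move=> FP GP; apply: (@recursive_comp2 (fun a b => b - a) G F) => //.
apply: eq_recursive (@recursive_prec (nth 0 ^~ 0) (fun m r v => r.-1) _ _).
- by move=> v; rewrite nth_behead; elim: (nth 0 v 0) => [|m /= ->] /=; lia.
- exact: recursive_proj.
- exact: recursive_pred (recursive_proj 1).
Qed.

Lemma recursive_if F G H :
  recursive F -> recursive G -> recursive H ->
    recursive (fun v => if F v == 0 then G v else H v).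
Proof.
move=> FP GP HP.
have ifP : recursive (fun v => if nth 0 v 0 == 0 then nth 0 v 1 else nth 0 v 2).
  apply: (eq_recursive _ (@recursive_prec (nth 0 ^~ 0) (fun m r v => nth 0 v 1) _ _)).
  - by move=> v; rewrite !nth_behead; case: (nth 0 v 0).
  - exact: recursive_proj.
  - by apply: eq_recursive (recursive_proj 3) => v; rewrite !nth_behead.
case: FP GP HP ifP => [f fP] [g gP] [h hP] [p pP].
exists (MComp p [:: f; g; h]) => v /=.
by exists [:: F v; G v; H v] => //; apply: (pP [:: _; _; _]).
Qed.

(** * Inverting the Cantor pairing *)

Definition tri s := 'C(s.+1, 2).

Lemma triS s : tri s.+1 = tri s + s.+1.
Proof. by rewrite /tri binS bin1. Qed.

Lemma leq_tri s t : s <= t -> tri s <= tri t.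
Proof.
elim: t => [|t IHt]; first by case: s.
by rewrite leq_eqVlt ltnS => /predU1P[-> //|/IHt]; rewrite triS; lia.
Qed.

Lemma recursive_tri F : recursive F -> recursive (fun v => tri (F v)).
Proof.
apply: recursive_comp1.
apply: eq_recursive (@recursive_prec (fun=> 0) (fun m r v => r + m.+1) _ _).
- by move=> v; elim: (nth 0 v 0) => //= m ->; rewrite triS.
- exact: recursive_const.
- by apply: recursive_add (recursive_proj 1)
  (recursive_succ (recursive_proj 0)).
Qed.

(** The index of the diagonal that contains [x]. Since [m < tri r.+1] throughout the recursion, the
    truncated difference is 1 exactly when [m.+1] opens a new diagonal, and 0 otherwise. *)
Definition croot (x : nat) : nat :=
  nat_rect (fun=> nat) 0 (fun m r => r + (m.+2 - tri r.+1)) x.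

Lemma croot_bounds x : tri (croot x) <= x < tri (croot x).+1.
Proof.
by elim: x => [|x] //=; have := triS (croot x).+1; have := triS (croot x);
  case: (ltngtP x.+1 (tri (croot x).+1)) => [h|h|h] h1 h2 h3;
  [have -> : x.+2 - tri (croot x).+1 = 0 by lia|
   lia | have -> : x.+2 - tri (croot x).+1 = 1 by lia];
  rewrite ?addn0 ?addn1; lia.
Qed.

Lemma croot_cpair a b : croot (cpair a b) = a + b.
Proof.
rewrite /cpair -/(tri (a + b)); set x := tri _ + b.
have /andP[h1 h2] := croot_bounds x.
have h3 : tri (a + b) <= x < tri (a + b).+1 by rewrite /x triS; lia.
by case: (ltngtP (croot x) (a + b)) => // /leq_tri; lia.
Qed.

Definition csnd x := x - tri (croot x).
Definition cfst x := croot x - csnd x.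

Lemma csnd_cpair a b : csnd (cpair a b) = b.
Proof. by rewrite /csnd croot_cpair /cpair /tri; lia. Qed.

Lemma cfst_cpair a b : cfst (cpair a b) = a.
Proof. by rewrite /cfst csnd_cpair croot_cpair; lia. Qed.

Lemma recursive_cpair F G : recursive F -> recursive G ->
  recursive (fun v => cpair (F v) (G v)).
Proof. by move=> FP GP; apply/recursive_add => //; apply: recursive_tri;
  apply: recursive_add. Qed.

Lemma recursive_croot F : recursive F -> recursive (fun v => croot (F v)).
Proof.
apply: recursive_comp1.
apply: (@recursive_prec (fun=> 0) (fun m r v => r + (m.+2 - tri r.+1))).
  exact: recursive_const.
apply: recursive_add (recursive_proj 1) (recursive_sub _ _).
  exact: recursive_succ (recursive_succ (recursive_proj 0)).
exact: recursive_tri (recursive_succ (recursive_proj 1)).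
Qed.

Lemma recursive_csnd F : recursive F -> recursive (fun v => csnd (F v)).
Proof. by move=> FP; apply: recursive_sub => //;
  apply/recursive_tri/recursive_croot. Qed.

Lemma recursive_cfst F : recursive F -> recursive (fun v => cfst (F v)).
Proof. by move=> FP; apply: recursive_sub;
  [apply: recursive_croot | apply: recursive_csnd]. Qed.

(** The predecessor undoes the successor in [code_seq]. As [ctail 0 = 0], iterating beyond the end
    of a list stays at the code of [[::]]. *)
Definition ctail x := csnd x.-1.

Lemma recursive_iter_ctail F G :
  recursive F -> recursive G -> recursive (fun v => iter (F v) ctail (G v)).
Proof.
apply: (@recursive_comp2 (fun m x => iter m ctail x)).
apply: eq_recursive (@recursive_prec (nth 0 ^~ 0) (fun m r v => ctail r) _ _).
- by move=> v; rewrite nth_behead; elim: (nth 0 v 0) => //= m ->.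
- exact: recursive_proj.
- exact: recursive_csnd (recursive_pred (recursive_proj 1)).
Qed.

(* The default element makes [nth] computable. *)
Class encodable (A : Type) := Encodable { enc : A -> nat; dflt : A }.

#[export] Instance nat_encodable : encodable nat := Encodable id 0.
#[export] Instance bool_encodable : encodable bool :=
  Encodable nat_of_bool false.
#[export] Instance int_encodable : encodable int := Encodable code_int 0%R.
#[export] Instance prod_encodable A B (eA : encodable A) (eB : encodable B) :
    encodable (A * B) :=
  Encodable (fun p => cpair (enc p.1) (enc p.2)) (dflt, dflt).
#[export] Instance seq_encodable A (eA : encodable A) : encodable (seq A) :=
  Encodable (code_seq enc) [::].

(* Nothing is required of [f] on numbers that are not codes. *)
Definition computable A B (eA : encodable A) (eB : encodable B) (F : A -> B) :=
  exists f, forall a, mueval f [:: enc a] (enc (F a)).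
Arguments computable {A B eA eB} F.

Section Combinators.
Context {A : Type} {eA : encodable A}.

Lemma eq_computable B (eB : encodable B) (F F' : A -> B) :
  F =1 F' -> computable F -> computable F'.
Proof. by move=> eqF [f fP]; exists f => v; rewrite -eqF. Qed.

Lemma computable_id : computable (fun a : A => a).
Proof. by exists (MProj 0). Qed.

Lemma computable_const B (eB : encodable B) (b : B) : computable (fun _ : A =>
  b).
Proof. by have [f fP] := recursive_const (enc b); exists f => a; apply: fP. Qed.

Lemma computable_comp B C (eB : encodable B) (eC : encodable C)
    (F : B -> C) (G : A -> B) :
  computable F -> computable G -> computable (fun a => F (G a)).
Proof.
move=> [f fP] [g gP]; exists (MComp f [:: g]) => a /=.
by exists [:: enc (G a)].
Qed.

Lemma computable_recursive B C (eB : encodable B) (eC : encodable C)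
    (F : B -> C) (F' : seq nat -> nat) (G : A -> B) :
  recursive F' -> (forall b, F' [:: enc b] = enc (F b)) -> computable G ->
  computable (fun a => F (G a)).
Proof.
move=> [f fP] FP; apply: computable_comp; exists f => b; rewrite -FP.
exact: fP.
Qed.

Lemma computable_pair B C (eB : encodable B) (eC : encodable C)
    (F : A -> B) (G : A -> C) :
  computable F -> computable G -> computable (fun a => (F a, G a)).
Proof.
move=> [f fP] [g gP]; have [p pP] :=
  recursive_cpair (recursive_proj 0) (recursive_proj 1).
exists (MComp p [:: f; g]) => a /=; exists [:: enc (F a); enc (G a)] => //.
Qed.

Lemma computable_fst B C (eB : encodable B) (eC : encodable C)
    (F : A -> B * C) : computable F -> computable (fun a => (F a).1).
Proof.
apply: (computable_recursive (F :=
  @fst B C)) (recursive_cfst (recursive_proj 0)) _ => b /=.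
exact: cfst_cpair.
Qed.

Lemma computable_snd B C (eB : encodable B) (eC : encodable C)
    (F : A -> B * C) : computable F -> computable (fun a => (F a).2).
Proof.
apply: (computable_recursive (F :=
  @snd B C)) (recursive_csnd (recursive_proj 0)) _ => b /=.
exact: csnd_cpair.
Qed.

Lemma computable_recursive2 B C D (eB : encodable B) (eC : encodable C)
    (eD : encodable D) (F : B -> C -> D) (F' : nat -> nat -> nat)
    (G : A -> B) (H : A -> C) :
  recursive (fun v => F' (nth 0 v 0) (nth 0 v 1)) ->
  (forall b c, F' (enc b) (enc c) = enc (F b c)) ->
  computable G -> computable H -> computable (fun a => F (G a) (H a)).
Proof.
move=> F'P FP [g gP] [h hP]; have [f fP] := F'P.
exists (MComp f [:: g; h]) => a /=; exists [:: enc (G a); enc (H a)] => //.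
by rewrite -FP; exact: (fP [:: _; _]).
Qed.

Lemma computable_succ (F : A -> nat) :
  computable F -> computable (fun a => (F a).+1).
Proof.
by apply: (computable_recursive (F :=
  S)) (recursive_succ (recursive_proj 0)) _ => b.
Qed.

Lemma computable_pred (F : A -> nat) :
  computable F -> computable (fun a => (F a).-1).
Proof.
by apply: (computable_recursive (F :=
  predn)) (recursive_pred (recursive_proj 0)) _ => b.
Qed.

Lemma computable_add (F G : A -> nat) :
  computable F -> computable G -> computable (fun a => F a + G a).
Proof.
by apply: (computable_recursive2 (F :=
  addn)) (recursive_add (recursive_proj 0) (recursive_proj 1)) _.
Qed.

Lemma computable_sub (F G : A -> nat) :
  computable F -> computable G -> computable (fun a => F a - G a).
Proof.
by apply: (computable_recursive2 (F :=
  subn)) (recursive_sub (recursive_proj 0) (recursive_proj 1)) _.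
Qed.

Lemma computable_leq (F G : A -> nat) :
  computable F -> computable G -> computable (fun a => F a <= G a).
Proof.
apply: (computable_recursive2 (F := leq) (F' := fun x y =>
  if x - y == 0 then 1 else 0)).
  by apply: recursive_if (recursive_sub (recursive_proj 0) (recursive_proj 1))
    _ _; exact: recursive_const.
by move=> b c /=; rewrite subn_eq0; case: leq.
Qed.

Lemma computable_nat_rect B (eB : encodable B)
    (N : A -> nat) (G : A -> B) (H : A -> nat -> B -> B) :
  computable N -> computable G ->
  computable (fun p : A * (nat * B) => H p.1 p.2.1 p.2.2) ->
  computable (fun a => nat_rect (fun=> B) (G a) (H a) (N a)).
Proof.
move=> [n nP] [g gP] [h hP].
(* [MPrec] calls its step function on [[:: m; r; enc a]], which [p] reassembles into the code of
   [(a, (m, r))]. *)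
have [p pP] := recursive_cpair (recursive_proj 2)
  (recursive_cpair (recursive_proj 0) (recursive_proj 1)).
exists (MComp (MPrec g (MComp h [:: p])) [:: n; MProj 0]) => a /=.
exists [:: N a; enc a] => //=; elim: (N a) => [|m IHm] //=.
exists (enc (nat_rect (fun=> B) (G a) (H a) m)) => //.
exists [:: enc (a, (m, nat_rect (fun=> B) (G a) (H a) m))].
  by split=> //; apply: (pP [:: _; _; _]).
exact: hP.
Qed.

End Combinators.

Lemma computable_if A B (eA : encodable A) (eB : encodable B) (b : A ->
  bool) (F G : A -> B) :
  computable b -> computable F -> computable G ->
  computable (fun a => if b a then F a else G a).
Proof.
move=> bP FP GP.
apply: (eq_computable (F := fun a =>
   nat_rect (fun=> B) (G a) (fun _ _ => F a) (nat_of_bool (b a)))).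
  by move=> a; case: (b a).
apply: computable_nat_rect => //.
apply: computable_comp FP _; exact: computable_fst computable_id.
Qed.

Lemma iter_ctail_enc A (eA : encodable A) (s : seq A) i :
  iter i ctail (enc s) = enc (drop i s).
Proof.
elim: i s => [|i IHi] s; first by rewrite drop0.
rewrite iterSr; case: s => [|x s]; first exact: (IHi [::]).
rewrite [drop _ _]/= -IHi; congr (iter _ _ _).
by rewrite /ctail /= csnd_cpair.
Qed.

Lemma enc_seq_eq0 A (eA : encodable A) (s : seq A) : (enc s == 0) = nilp s.
Proof. by case: s. Qed.

(** Primitive recursion needs its number of rounds in advance: this lets the code itself serve as
    the bound when the length is computed by counting nonempty tails. *)
Lemma size_enc A (eA : encodable A) (s : seq A) : size s <= enc s.
Proof.
elim: s => //= x s IHs; rewrite ltnS (leq_trans IHs)//= /cpair; lia.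
Qed.

Section SeqCombinators.
Context {A B : Type} {eA : encodable A} {eB : encodable B}.

Lemma computable_nil : computable (fun _ : A => [::] : seq B).
Proof. exact: computable_const. Qed.

Lemma computable_cons (F : A -> B) (G : A -> seq B) :
  computable F -> computable G -> computable (fun a => F a :: G a).
Proof.
by apply: (computable_recursive2 (F := cons) (F' := fun x y => (cpair x y).+1))
     (recursive_succ (recursive_cpair (recursive_proj 0) (recursive_proj 1))) _.
Qed.

Lemma computable_nth (F : A -> seq B) (G : A -> nat) :
  computable F -> computable G -> computable (fun a => nth dflt (F a) (G a)).
Proof.
apply: (computable_recursive2 (F := nth dflt)
  (F' := fun x i => if iter i ctail x == 0 then enc (dflt : B)
                    else cfst (iter i ctail x).-1)).
  apply: recursive_if; [|exact:
    recursive_const|apply/recursive_cfst/recursive_pred];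
  exact: recursive_iter_ctail (recursive_proj 1) (recursive_proj 0).
move=> s i; rewrite iter_ctail_enc enc_seq_eq0.
case: (ltnP i (size s)) => [lt_i_s|le_s_i].
  by rewrite (drop_nth dflt) //= cfst_cpair.
by rewrite drop_oversize // nth_default.
Qed.

Lemma computable_size (F : A -> seq B) :
  computable F -> computable (fun a => size (F a)).
Proof.
pose sz x := nat_rect (fun=> nat) 0
  (fun m r => r + (if iter m ctail x == 0 then 0 else 1)) x.
apply: (computable_recursive (F := @size B) (F' := fun v => sz (nth 0 v 0))).
  have szP := @recursive_prec (fun=> 0)
    (fun m r v => r + (if iter m ctail (nth 0 v 0) == 0 then 0 else 1)).
  apply: (@recursive_comp2 (fun x y => nat_rect (fun=> nat) 0
    (fun m r => r + (if iter m ctail y == 0 then 0 else 1)) x)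
    (nth 0 ^~ 0) (nth 0 ^~ 0)); try exact: recursive_proj.
  apply: eq_recursive (szP _ _); first by move=> v; rewrite nth_behead.
    exact: recursive_const.
  apply: recursive_add (recursive_proj 1) (recursive_if _ _ _);
    try exact: recursive_const.
  apply: recursive_iter_ctail (recursive_proj 0) _.
  by apply: eq_recursive (recursive_proj 2) => v; rewrite !nth_behead.
move=> s; rewrite /sz [nth _ _ _]/=.
pose c := @enc _ (seq_encodable eB) s.
suff H m : nat_rect (fun=> nat) 0
    (fun m r => r + (if iter m ctail c == 0 then 0 else 1)) m = minn m (size s).
  by rewrite [LHS](H c); apply/minn_idPr; exact: size_enc.
elim: m => [|m IHm] /=; first by rewrite min0n.
rewrite IHm /c iter_ctail_enc enc_seq_eq0 /nilp size_drop subn_eq0.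
by case: leqP; lia.
Qed.

End SeqCombinators.

Lemma computable_foldr A B C (eA : encodable A) (eB : encodable B)
    (eC : encodable C) (f : A -> B -> C -> C) (g : A -> C) (s : A -> seq B) :
  computable (fun p : A * (B * C) => f p.1 p.2.1 p.2.2) ->
  computable g -> computable s ->
  computable (fun a => foldr (f a) (g a) (s a)).
Proof.
move=> fP gP sP.
(* The recursion runs from the end of the list: after [m] rounds it holds the fold over the last [m]
   elements. *)
apply: (eq_computable (F := fun a => nat_rect (fun=> C) (g a)
   (fun m r => f a (nth dflt (s a) (size (s a) - m.+1)) r) (size (s a)))).
  move=> a; suff H m : m <= size (s a) ->
     nat_rect (fun=> C) (g a)
       (fun m r => f a (nth (@dflt B eB) (s a) (size (s a) - m.+1)) r) m =
     foldr (f a) (g a) (drop (size (s a) - m) (s a)).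
    by rewrite H // subnn drop0.
  elim: m => [|m IHm] lt_m /=; first by rewrite subn0 drop_size.
  rewrite IHm; last exact: ltnW.
  rewrite [in RHS](drop_nth (@dflt B eB)); last lia.
  by rewrite /= -subSn // subSS.
have s1 : computable (fun p : A * (nat * C) => s p.1).
  exact: computable_comp sP (computable_fst computable_id).
have m1 : computable (fun p : A * (nat * C) => p.2.1).
  exact: computable_fst (computable_snd computable_id).
apply: computable_nat_rect => //; first exact: computable_size.
apply: (computable_comp (F := fun p : A * (B * C) => f p.1 p.2.1 p.2.2)
  (G := fun p : A * (nat * C) =>
     (p.1, (nth (@dflt B eB) (s p.1) (size (s p.1) - p.2.1.+1), p.2.2)))) => //.
apply: computable_pair; first exact: computable_fst computable_id.
apply: computable_pair; last exact: computable_snd (computable_snd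
  computable_id).
apply: computable_nth => //; apply: computable_sub;
  first exact: computable_size.
exact: computable_succ.
Qed.

(** * Sparse matrices over the free monoid on the letters *)

Section Sparse.
Variables (I : eqType) (X : Type) (inv : X -> X).

(* The entry ((i, j), (z, w)) contributes z w to the coefficient (i, j). *)
Definition smatrix := seq ((I * I) * (int * seq X)).

Definition winv (w : seq X) : seq X := rev (map inv w).

Definition smul (A B : smatrix) : smatrix :=
  flatten [seq [seq ((a.1.1, b.1.2), ((a.2.1 * b.2.1)%R, a.2.2 ++ b.2.2))
                  | b <- B & a.1.2 == b.1.1] | a <- A].

Definition sstar (A : smatrix) : smatrix :=
  [seq ((a.1.2, a.1.1), (a.2.1, winv a.2.2)) | a <- A].

Definition sone (s : seq I) : smatrix := [seq ((i, i), (1%R, [::])) | i <- s].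

Definition sscale (z : int) (A : smatrix) : smatrix :=
  [seq (a.1, ((z * a.2.1)%R, a.2.2)) | a <- A].

(** This bounds the operator norm on l^2 and the absolute row sums in every finite model. *)
Definition snorm (A : smatrix) : nat := \sum_(a <- A) `|a.2.1|%N.

(** [P] stands for evaluating to 1 in the group, or for being a loop at a given vertex of a graph;
    the two traces are compared for the same list [A]. *)
Definition strace (P : pred (seq X)) (A : smatrix) : int :=
  (\sum_(a <- A | (a.1.1 == a.1.2) && P a.2.2) a.2.1)%R.

(* C - A^* A *)
Definition sdefect (C : nat) (s : seq I) (A : smatrix) : smatrix :=
  sscale C%:Z (sone s) ++ sscale (- 1)%R (smul (sstar A) A).

Definition spow (s : seq I) (A : smatrix) (m : nat) : smatrix :=
  iter m (smul A) (sone s).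

(* The summand 2 keeps this bound on the norm of A^* A at least 2, so that its
   powers grow. *)
Definition sbound (A : smatrix) : nat := snorm A ^ 2 + 2.

Definition sprec (kG : nat) (s : seq I) : nat := (2 * (size s * kG)).+1.

Definition sexp (kG : nat) (s : seq I) (A : smatrix) : nat :=
  sprec kG s * sbound A ^ (sprec kG s).+1.

(** The inequality k(G) a_m < 1 with the denominator C^m cleared, so that only integers are
    compared. *)
Definition kernel_test (kG : nat) (P : pred (seq X)) (s : seq I)
    (A : smatrix) : bool :=
  (kG%:Z * strace P (spow s (sdefect (sbound A) s A) (sexp kG s A)) <
   (sbound A ^ sexp kG s A)%:Z)%R.

End Sparse.

Section SparseMap.
Variables (I J : eqType) (X Y : Type) (invX : X -> X) (invY : Y -> Y).
Variables (f : I -> J) (h : X -> Y).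
Hypotheses (f_inj : injective f) (h_inv : forall x, h (invX x) = invY (h x)).

Definition smap (A : smatrix I X) : smatrix J Y :=
  [seq ((f a.1.1, f a.1.2), (a.2.1, map h a.2.2)) | a <- A].

Lemma smap_cat A B : smap (A ++ B) = smap A ++ smap B.
Proof. exact: map_cat. Qed.

Lemma smap_smul A B : smap (smul A B) = smul (smap A) (smap B).
Proof.
rewrite /smap /smul map_flatten -!map_comp; congr flatten.
apply: eq_map => a /=; rewrite filter_map -!map_comp.
rewrite [in RHS](@eq_filter _ _ (fun b => a.1.2 == b.1.1)); last first.
  by move=> b; exact: (inj_eq f_inj).
by apply: eq_map => b /=; rewrite map_cat.
Qed.

Lemma smap_sstar A : smap (sstar invX A) = sstar invY (smap A).
Proof.
rewrite /smap /sstar -!map_comp; apply: eq_map => a /=.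
by rewrite /winv map_rev -!map_comp (eq_map (g := invY \o h)).
Qed.

Lemma smap_sone s : smap (sone X s) = sone Y (map f s).
Proof. by rewrite /smap /sone -!map_comp. Qed.

Lemma smap_sscale z A : smap (sscale z A) = sscale z (smap A).
Proof. by rewrite /smap /sscale -!map_comp. Qed.

Lemma snorm_smap A : snorm (smap A) = snorm A.
Proof. by rewrite /snorm big_map. Qed.

Lemma smap_sdefect C s A :
  smap (sdefect invX C s A) = sdefect invY C (map f s) (smap A).
Proof.
by rewrite /sdefect smap_cat !smap_sscale smap_sone smap_smul smap_sstar.
Qed.

Lemma smap_spow s A m : smap (spow s A m) = spow (map f s) (smap A) m.
Proof.
by elim: m => [|m IHm]; [exact: smap_sone | rewrite /= smap_smul -IHm].
Qed.

Lemma strace_smap (P : pred (seq X)) (Q : pred (seq Y)) A :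
  (forall w, Q (map h w) = P w) -> strace Q (smap A) = strace P A.
Proof.
move=> PQ; rewrite /strace big_map; apply: eq_bigl => a /=.
by rewrite PQ; congr (_ && _); exact: (inj_eq f_inj).
Qed.

(** This transports the test from ordinals and letters to the natural numbers on which the algorithm
    works. Indices are compared with each other, hence the injectivity of [f]; letters are seen only
    through the predicate and the inversion. *)
Lemma kernel_test_smap kG (P : pred (seq X)) (Q : pred (seq Y)) s A :
  (forall w, Q (map h w) = P w) ->
  kernel_test invY kG Q (map f s) (smap A) = kernel_test invX kG P s A.
Proof.
move=> PQ; rewrite /kernel_test /sexp /sprec /sbound snorm_smap size_map.
by rewrite -smap_sdefect -smap_spow (strace_smap _ PQ).
Qed.

End SparseMap.

(** * The test is computable *)

Lemma computable_comp2 A B C D (eA : encodable A) (eB : encodable B)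
    (eC : encodable C) (eD : encodable D) (F : B -> C -> D)
    (G : A -> B) (H : A -> C) :
  computable (fun p : B * C => F p.1 p.2) -> computable G -> computable H ->
  computable (fun a => F (G a) (H a)).
Proof.
move=> FP GP HP.
exact: (computable_comp (G := fun a => (G a, H a)) FP (computable_pair GP HP)).
Qed.

Lemma computable_mul A (eA : encodable A) (F G : A -> nat) :
  computable F -> computable G -> computable (fun a => F a * G a).
Proof.
move=> FP GP; apply: (eq_computable (F := fun a =>
   nat_rect (fun=> nat) 0 (fun _ r => r + G a) (F a))).
  by move=> a; elim: (F a) => //= m ->; rewrite mulSn addnC.
apply: computable_nat_rect => //; first exact: computable_const.
apply: computable_add; first exact: computable_snd (computable_snd
  computable_id).
exact: computable_comp GP (computable_fst computable_id).
Qed.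

Lemma computable_expn A (eA : encodable A) (F G : A -> nat) :
  computable F -> computable G -> computable (fun a => F a ^ G a).
Proof.
move=> FP GP; apply: (eq_computable (F := fun a =>
   nat_rect (fun=> nat) 1 (fun _ r => F a * r) (G a))).
  by move=> a; elim: (G a) => //= m ->; rewrite expnS.
apply: computable_nat_rect => //; first exact: computable_const.
apply: computable_mul; last exact: computable_snd (computable_snd
  computable_id).
exact: computable_comp FP (computable_fst computable_id).
Qed.

Lemma computable_iter A (eA : encodable A) B (eB : encodable B) (N : A ->
  nat) (F : A -> B -> B)
    (G : A -> B) :
  computable N -> computable (fun p : A * B => F p.1 p.2) -> computable G ->
  computable (fun a => iter (N a) (F a) (G a)).
Proof.
move=> NP FP GP.
apply: (eq_computable (F := fun a =>
   nat_rect (fun=> B) (G a) (fun _ r => F a r) (N a))).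
  by move=> a; elim: (N a) => //= m ->.
apply: computable_nat_rect => //.
apply: (computable_comp2 FP).
  exact: computable_fst computable_id.
exact: computable_snd (computable_snd computable_id).
Qed.

Lemma computable_andb A (eA : encodable A) (F G : A -> bool) :
  computable F -> computable G -> computable (fun a => F a && G a).
Proof. by move=> FP GP; apply: computable_if => //;
  exact: computable_const. Qed.

Lemma computable_negb A (eA : encodable A) (F : A -> bool) :
  computable F -> computable (fun a => ~~ F a).
Proof. by move=> FP; apply: computable_if => //; exact: computable_const. Qed.

Lemma computable_eqn A (eA : encodable A) (F G : A -> nat) :
  computable F -> computable G -> computable (fun a => F a == G a).
Proof.
move=> FP GP; apply: (eq_computable (F := fun a =>
  (F a <= G a) && (G a <= F a))).
  by move=> a; rewrite -eqn_leq.
by apply: computable_andb; apply: computable_leq.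
Qed.

Lemma computable_odd A (eA : encodable A) (F : A -> nat) :
  computable F -> computable (fun a => odd (F a)).
Proof.
move=> FP; apply: (eq_computable (F := fun a => iter (F a) negb false)).
  by move=> a; elim: (F a) => //= m ->.
apply: (@computable_iter A _ bool _ F (fun=> negb) (fun=> false)) => //;
  last exact: computable_const.
exact: computable_negb (computable_snd computable_id).
Qed.

Lemma computable_half A (eA : encodable A) (F : A -> nat) :
  computable F -> computable (fun a => (F a)./2).
Proof.
move=> FP; apply: (eq_computable (F := fun a => 
   nat_rect (fun=> nat) 0 (fun m r => if odd m then r.+1 else r) (F a))).
  move=> a; elim: (F a) => //= m ->; rewrite uphalf_half.
  by case: odd.
apply: (@computable_nat_rect _ _ _ _ F (fun=> 0)
  (fun _ m r => if odd m then r.+1 else r)) => //;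
    first exact: computable_const.
apply: computable_if; first exact: computable_odd (computable_fst
  (computable_snd computable_id)).
  exact: computable_succ (computable_snd (computable_snd computable_id)).
exact: computable_snd (computable_snd computable_id).
Qed.

Lemma computable_cat A (eA : encodable A) B (eB : encodable B) (F G : A ->
  seq B) :
  computable F -> computable G -> computable (fun a => F a ++ G a).
Proof.
move=> FP GP.
apply: (eq_computable (F := fun a => foldr (fun x r => x :: r) (G a) (F a))).
  by move=> a; elim: (F a) => //= x s ->.
apply: computable_foldr => //; apply: computable_cons.
  exact: computable_fst (computable_snd computable_id).
exact: computable_snd (computable_snd computable_id).
Qed.

Lemma computable_flatten A (eA : encodable A) B (eB : encodable B) (F : A ->
  seq (seq B)) :
  computable F -> computable (fun a => flatten (F a)).
Proof.
move=> FP; apply: (computable_foldr _ (computable_nil) FP).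
apply: computable_cat.
  exact: computable_fst (computable_snd computable_id).
exact: computable_snd (computable_snd computable_id).
Qed.

Lemma computable_map A (eA : encodable A) B D (eB : encodable B) (eD :
  encodable D)
    (F : A -> B -> D) (G : A -> seq B) :
  computable (fun p : A * B => F p.1 p.2) -> computable G ->
  computable (fun a => map (F a) (G a)).
Proof.
move=> FP GP.
apply: (eq_computable (F := fun a => foldr (fun x r => F a x :: r) [::] (G a))).
  by move=> a; elim: (G a) => //= x s ->.
apply: computable_foldr => //; last exact: computable_nil.
apply: computable_cons; last exact: computable_snd (computable_snd
  computable_id).
apply: (computable_comp2 FP).
  exact: computable_fst computable_id.
exact: computable_fst (computable_snd computable_id).
Qed.

Lemma computable_filter A (eA : encodable A) B (eB : encodable B) (F : A ->
  pred B) (G : A -> seq B) :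
  computable (fun p : A * B => F p.1 p.2) -> computable G ->
  computable (fun a => seq.filter (F a) (G a)).
Proof.
move=> FP GP.
apply: (eq_computable (F := fun a => foldr (fun x r =>
  if F a x then x :: r else r) [::] (G a))).
  by move=> a; elim: (G a) => //= x s ->.
have xP : computable (fun p : A * (B * seq B) => p.2.1).
  exact: computable_fst (computable_snd computable_id).
have sP : computable (fun p : A * (B * seq B) => p.2.2).
  exact: computable_snd (computable_snd computable_id).
apply: computable_foldr => //; last exact: computable_nil.
apply: computable_if => //; last exact: computable_cons.
apply: (computable_comp2 FP) => //.
exact: computable_fst computable_id.
Qed.

Lemma computable_rev A (eA : encodable A) B (eB : encodable B) (F : A ->
  seq B) :
  computable F -> computable (fun a => rev (F a)).
Proof.
move=> FP.
apply: (eq_computable (F := fun a => foldr (fun x r =>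
  r ++ [:: x]) [::] (F a))).
  by move=> a; elim: (F a) => //= x s ->; rewrite rev_cons -cats1.
apply: computable_foldr => //; last exact: computable_nil.
apply: computable_cat; first exact: computable_snd (computable_snd
  computable_id).
apply: computable_cons; last exact: computable_nil.
exact: computable_fst (computable_snd computable_id).
Qed.

Lemma computable_iota A (eA : encodable A) (F : A -> nat) :
  computable F -> computable (fun a => iota 0 (F a)).
Proof.
move=> FP; apply: (eq_computable (F := fun a =>
   nat_rect (fun=> seq nat) [::] (fun m r => r ++ [:: m]) (F a))).
  by move=> a; elim: (F a) => //= m ->;
    rewrite -[RHS]/(iota 0 m.+1) -[m.+1]addn1 iotaD.
apply: (@computable_nat_rect _ _ _ _ F (fun=> [::])
  (fun _ m r => r ++ [:: m])) => //; first exact: computable_nil.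
apply: computable_cat; first exact: computable_snd (computable_snd
  computable_id).
apply: computable_cons; last exact: computable_nil.
exact: computable_fst (computable_snd computable_id).
Qed.

(** * Arithmetic of coded integers, handled as differences of natural numbers *)

Definition posz z : nat := match z with Posz m => m | Negz _ => 0 end.
Definition negz z : nat := match z with Posz _ => 0 | Negz m => m.+1 end.
Definition diffz (m n : nat) : nat :=
  if n <= m then (m - n).*2 else (n - m).-1.*2.+1.

Lemma poszBnegz z : z = ((posz z)%:Z - (negz z)%:Z)%R.
Proof. by case: z => m /=; rewrite ?subr0 // sub0r NegzE. Qed.

Lemma diffzE m n : diffz m n = code_int (m%:Z - n%:Z)%R.
Proof.
rewrite /diffz; case: leqP => h; first by rewrite subzn.
by rewrite -opprB subzn 1?ltnW //; case: (n - m) (subn_gt0 m n) => [|r];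
  rewrite ?h // -NegzE.
Qed.

Lemma code_int_odd z : odd (code_int z) = (z < 0)%R.
Proof. by case: z => m /=; rewrite odd_double. Qed.

Lemma code_int_half z : (code_int z)./2 = if (z < 0)%R then (negz z).-1 else
  posz z.
Proof. by case: z => m /=; rewrite ?doubleK ?uphalf_double. Qed.

Lemma computable_code_int A (eA : encodable A) (F : A -> int) :
  computable F -> computable (fun a => code_int (F a)).
Proof. by move=> [f fP]; exists f. Qed.

Lemma computable_posz A (eA : encodable A) (F : A -> int) :
  computable F -> computable (fun a => posz (F a)).
Proof.
move=> /computable_code_int FP; apply: (eq_computable (F := fun a => 
   if odd (code_int (F a)) then 0 else (code_int (F a))./2)).
  by move=> a; rewrite code_int_odd code_int_half; case: (F a).
apply: computable_if; [exact: computable_odd|exact: computable_const|].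
exact: computable_half.
Qed.

Lemma computable_negz A (eA : encodable A) (F : A -> int) :
  computable F -> computable (fun a => negz (F a)).
Proof.
move=> /computable_code_int FP; apply: (eq_computable (F := fun a => 
   if odd (code_int (F a)) then (code_int (F a))./2.+1 else 0)).
  by move=> a; rewrite code_int_odd code_int_half; case: (F a).
apply: computable_if; [exact: computable_odd| |exact: computable_const].
exact: computable_succ (computable_half FP).
Qed.

Lemma computable_subz A (eA : encodable A) (F G : A -> nat) :
  computable F -> computable G -> computable (fun a => ((F a)%:Z - (G a)%:Z)%R).
Proof.
move=> FP GP.
have: computable (fun a => diffz (F a) (G a)).
  apply: computable_if; first exact: computable_leq.
    apply: (eq_computable (F := fun a => (F a - G a) + (F a - G a))).
      by move=> a; rewrite addnn.
    by apply: computable_add; apply: computable_sub.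
  apply: computable_succ.
  apply: (eq_computable (F := fun a => (G a - F a).-1 + (G a - F a).-1)).
    by move=> a; rewrite addnn.
  by apply: computable_add; apply/computable_pred/computable_sub.
by case=> f fP; exists f => a; move: (fP a); rewrite /= diffzE.
Qed.

Lemma computable_addz A (eA : encodable A) (F G : A -> int) :
  computable F -> computable G -> computable (fun a => (F a + G a)%R).
Proof.
move=> FP GP; apply: (eq_computable (F := fun a =>
   ((posz (F a) + posz (G a))%N%:Z - (negz (F a) + negz (G a))%N%:Z)%R)).
  by move=> a; rewrite [in RHS](poszBnegz (F a)) [in RHS](poszBnegz (G a)); lia.
by apply: computable_subz; apply: computable_add;
  try apply: computable_posz; try apply: computable_negz.
Qed.

Lemma computable_mulz A (eA : encodable A) (F G : A -> int) :
  computable F -> computable G -> computable (fun a => (F a * G a)%R).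
Proof.
move=> FP GP; apply: (eq_computable (F := fun a =>
   ((posz (F a) * posz (G a) + negz (F a) * negz (G a))%N%:Z -
    (posz (F a) * negz (G a) + negz (F a) * posz (G a))%N%:Z)%R)).
  by move=> a; rewrite [in RHS](poszBnegz (F a)) [in RHS](poszBnegz (G a)); lia.
by apply: computable_subz; apply: computable_add; apply: computable_mul;
  try apply: computable_posz; try apply: computable_negz.
Qed.

Lemma computable_natz A (eA : encodable A) (F : A -> nat) :
  computable F -> computable (fun a => Posz (F a)).
Proof.
move=> FP; apply: (eq_computable (F := fun a => ((F a)%:Z - 0%N%:Z)%R)).
  by move=> a; rewrite subr0.
by apply: computable_subz => //; exact: computable_const.
Qed.

Lemma computable_absz A (eA : encodable A) (F : A -> int) :
  computable F -> computable (fun a => `|F a|%N).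
Proof.
move=> FP; apply: (eq_computable (F := fun a => posz (F a) + negz (F a))).
  by move=> a; case: (F a) => m /=; lia.
by apply: computable_add; [apply: computable_posz | apply: computable_negz].
Qed.

Lemma computable_ltz A (eA : encodable A) (F G : A -> int) :
  computable F -> computable G -> computable (fun a => (F a < G a)%R).
Proof.
move=> FP GP; apply: (eq_computable (F := fun a =>
   (posz (F a) + negz (G a)).+1 <= posz (G a) + negz (F a))).
  by move=> a; rewrite [in RHS](poszBnegz (F a)) [in RHS](poszBnegz (G a)); lia.
apply: computable_leq; first apply: computable_succ; apply: computable_add;
  by [apply: computable_posz | apply: computable_negz].
Qed.

(** Syntax-directed search on the head of the body. The last branch eta-expands, so that the
    patterns above it can match. *)
Ltac computable_step :=
  match goal with
  | |- computable (fun _ => ?c) => apply: computable_const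
  | |- computable (fun a => a) => apply: computable_id
  | |- computable (fun a => _.1) => apply: computable_fst
  | |- computable (fun a => _.2) => apply: computable_snd
  | |- computable (fun a => (_, _)) => apply: computable_pair
  | |- computable (fun a => _.+1) => apply: computable_succ
  | |- computable (fun a => _ :: _) => apply: computable_cons
  | |- computable (fun a => _ ++ _) => apply: computable_cat
  | |- computable (fun a => flatten _) => apply: computable_flatten
  | |- computable (fun a => map _ _) => apply: computable_map
  | |- computable (fun a => seq.filter _ _) => apply: computable_filter
  | |- computable (fun a => rev _) => apply: computable_rev
  | |- computable (fun a => iota 0 _) => apply: computable_iota
  | |- computable (fun a => size _) => apply: computable_size
  | |- computable (fun a => (_ + _)%N) => apply: computable_add
  | |- computable (fun a => (_ * _)%N) => apply: computable_mul
  | |- computable (fun a => (_ ^ _)%N) => apply: computable_expn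
  | |- computable (fun a => (_ + _)%R) => apply: computable_addz
  | |- computable (fun a => (_ * _)%R) => apply: computable_mulz
  | |- computable (fun a => (_ < _)%R) => apply: computable_ltz
  | |- computable (fun a => absz _) => apply: computable_absz
  | |- computable (fun a => Posz _) => apply: computable_natz
  | |- computable (fun a => _ && _) => apply: computable_andb
  | |- computable (fun a => odd _) => apply: computable_odd
  | |- computable (fun a => @eq_op _ _ _) => apply: computable_eqn
  | |- computable (fun a => if _ then _ else _) => apply: computable_if
  | |- computable (fun a => iter _ _ _) => apply: computable_iter
  | |- computable (fun a => foldr _ _ _) => apply: computable_foldr
  | |- computable (fun a => nth _ _ _) => apply: computable_nth
  | |- computable (fun a => _.-1) => apply: computable_pred
  | |- @computable ?A _ _ _ ?f =>
      lazymatch f with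
      | fun _ => _ => fail
      | _ => change (computable (fun a : A => f a))
      end
  end.

Ltac computable_tac := repeat (assumption || computable_step).

Section SparseComputable.
Variables (inv : nat -> nat).
Hypothesis inv_comp : computable inv.
Notation smx := (smatrix nat nat).

Lemma computable_smul A (eA : encodable A) (F G : A -> smx) :
  computable F -> computable G -> computable (fun a => smul (F a) (G a)).
Proof.
move=> FP GP; rewrite /smul; computable_tac.
all: try exact: computable_comp FP (computable_fst computable_id).
all: try exact: computable_comp GP (computable_fst computable_id).
Qed.

Lemma computable_sstar A (eA : encodable A) (F : A -> smx) :
  computable F -> computable (fun a => sstar inv (F a)).
Proof.
move=> FP; rewrite /sstar /winv; computable_tac.
apply: (computable_comp inv_comp); computable_tac.
Qed.

Lemma computable_sone A (eA : encodable A) (F : A -> seq nat) :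
  computable F -> computable (fun a => sone nat (F a)).
Proof. by move=> FP; rewrite /sone; computable_tac. Qed.

Lemma computable_sscale A (eA : encodable A) (z : A -> int) (F : A -> smx) :
  computable z -> computable F -> computable (fun a => sscale (z a) (F a)).
Proof.
move=> zP FP; rewrite /sscale; computable_tac.
exact: computable_comp zP (computable_fst computable_id).
Qed.

Lemma computable_snorm A (eA : encodable A) (F : A -> smx) :
  computable F -> computable (fun a => snorm (F a)).
Proof.
move=> FP; rewrite /snorm.
apply: (eq_computable (F := fun a => foldr (fun x r =>
  `|x.2.1|%N + r) 0 (F a))).
  by move=> a; rewrite unlock; elim: (F a) => //= x s ->.
by computable_tac.
Qed.

Lemma computable_strace A (eA : encodable A) (P : pred (seq nat)) (F : A ->
  smx) :
  computable P -> computable F -> computable (fun a => strace P (F a)).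
Proof.
move=> PP FP; rewrite /strace.
apply: (eq_computable (F := fun a => foldr (fun x r =>
  if (x.1.1 == x.1.2) && P x.2.2 then (x.2.1 + r)%R else r) 0%R (F a))).
  by move=> a; rewrite unlock; elim: (F a) => //= x s ->.
computable_tac.
apply: (computable_comp PP); computable_tac.
Qed.

End SparseComputable.

Lemma computable_kernel_test A (eA : encodable A) (inv : nat -> nat) kG
    (P : pred (seq nat)) (s : A -> seq nat) (F : A -> smatrix nat nat) :
  computable inv -> computable P -> computable s -> computable F ->
  computable (fun a => kernel_test inv kG P (s a) (F a)).
Proof.
move=> invP PP sP FP; rewrite /kernel_test /spow.
have boundP : computable (fun a => sbound (F a)).
  by rewrite /sbound; computable_tac; exact: computable_snorm.
have expP : computable (fun a => sexp kG (s a) (F a)).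
  by rewrite /sexp /sprec; computable_tac.
apply: computable_ltz; last by computable_tac.
apply: computable_mulz; first by computable_tac.
apply: computable_strace => //.
apply: computable_iter => //; last exact: computable_sone.
apply: computable_smul; last by computable_tac.
apply: (computable_comp (F := fun a => sdefect inv (sbound (F a)) (s a) (F a))
  (G := fst)); last by computable_tac.
rewrite /sdefect; computable_tac; apply: computable_sscale; computable_tac.
- exact: computable_sone.
- apply: computable_smul => //; exact: computable_sstar.
Qed.

(** * Reading the coded input matrix as a sparse matrix *)

Definition smatrix_of_rows X (D : seq (seq (seq (int * seq X)))) :
    smatrix nat X :=
  flatten [seq flatten [seq [seq ((i, j), t) | t <- nth [::] (nth [::] D i) j]
                          | j <- iota 0 (size D)] | i <- iota 0 (size D)].

Definition entries n k (M : 'M[formal n]_k) : smatrix 'I_k (letter n) :=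
  flatten [seq flatten [seq [seq ((i, j), t) | t <- M i j] | j <- enum 'I_k]
             | i <- enum 'I_k].

Definition code_rows n k (M : 'M[formal n]_k) :
  seq (seq (seq (int * seq nat))) :=
  [seq [seq [seq (t.1, map (@code_letter n) t.2) | t <- M i j] | j <- enum 'I_k]
     | i <- enum 'I_k].

Lemma code_seq_map T U (c : U -> nat) (g : T -> U) s :
  code_seq c (map g s) = code_seq (c \o g) s.
Proof. by rewrite /code_seq foldr_map. Qed.

Lemma eq_code_seq T (c c' : T -> nat) : c =1 c' -> code_seq c =1 code_seq c'.
Proof. by move=> eqc; elim=> //= x s ->; rewrite eqc. Qed.

Lemma enc_code_rows n k (M : 'M[formal n]_k) :
  enc (code_rows M) = code_matrix M.
Proof.
rewrite /= code_seq_map; apply: eq_code_seq => i /=.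
rewrite code_seq_map; apply: eq_code_seq => j /=.
rewrite code_seq_map; apply: eq_code_seq => t /=.
by rewrite code_seq_map.
Qed.

(** What the algorithm reads off the code of [M] is a renaming of [entries M], which puts
    [kernel_test_smap] in force. *)
Lemma smap_entries n k (M : 'M[formal n]_k) :
  smap (val : 'I_k -> nat) (@code_letter n) (entries M) =
  smatrix_of_rows (code_rows M).
Proof.
rewrite /smap /entries /smatrix_of_rows [size _](size_map _) size_enum_ord.
rewrite -val_enum_ord map_flatten -!map_comp; congr flatten.
apply: eq_map => i /=; rewrite map_flatten -!map_comp; congr flatten.
apply: eq_map => j /=; rewrite -!map_comp.
rewrite (nth_map i) ?size_enum_ord // (nth_map j) ?size_enum_ord //.
by rewrite !nth_ord_enum -map_comp; apply: eq_map => t /=.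
Qed.

(** A letter has code 2 i + b, so inversion flips the lowest bit. *)
Definition code_linv (c : nat) : nat := if odd c then c.-1 else c.+1.

Lemma code_letter_linv n (l : letter n) :
  code_letter (linv l) = code_linv (code_letter l).
Proof.
case: l => i b; rewrite /code_linv /code_letter /= oddD odd_double.
by case: b => /=; lia.
Qed.

(** There are finitely many letters, so any function on them, however it was chosen, can be
    hard-wired into an algorithm as a table. *)
Lemma letter_table n T (x0 : T) (phi : letter n -> T) :
  exists t : seq T, forall l, nth x0 t (code_letter l) = phi l.
Proof.
exists (mkseq (fun c => if insub c./2 is Some i then phi (i, odd c) else x0)
              n.*2) => -[i b].
have hi : (code_letter (i, b))./2 = i :> nat.
  by rewrite /code_letter /= halfD odd_double doubleK /=; case: b => /=; lia.
rewrite nth_mkseq; last by rewrite /code_letter /=; have := ltn_ord i;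
  case: (b); lia.
rewrite hi valK; congr (phi (_, _)).
by rewrite /code_letter /= oddD odd_double; case: (b).
Qed.

(** * Change of generators, and the test as an algorithm *)

Section WordProblem.
Variables (G : groupType).

Lemma weval_cat n (gens : 'I_n -> G) u v :
  weval gens (u ++ v) = (weval gens u * weval gens v)%g.
Proof. by elim: u => [|l u IHu] /=; rewrite ?mul1g // IHu mulgA. Qed.

Lemma weval_flatten n n' (gens : 'I_n -> G) (gens' : 'I_n' -> G)
    (sub : letter n -> word n') w :
  (forall l, weval gens' (sub l) = weval gens [:: l]) ->
  weval gens' (flatten (map sub w)) = weval gens w.
Proof.
move=> subP; elim: w => //= l w IHw.
by rewrite weval_cat IHw subP /= mulg1.
Qed.

Lemma weval_winv n (gens : 'I_n -> G) w :
  weval gens (winv (@linv n) w) = (weval gens w)^-1%g.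
Proof.
rewrite /winv; elim: w => [|l w IHw] /=; first by rewrite invg1.
rewrite rev_cons -cats1 weval_cat IHw /= mulg1 invgM; congr (_ * _)%g.
by case: l.2; rewrite ?invgK.
Qed.

(** Words are chosen for the generators only; inverse letters receive the formal inverses. The
    second clause thus holds on the nose, and a substituted partial action remains invertible. *)
Lemma word_substitution n n' (gens : 'I_n -> G) (gens' : 'I_n' -> G) :
  generates gens' ->
  exists sub : letter n -> word n',
    (forall l, weval gens' (sub l) = weval gens [:: l]) /\
    (forall l, sub (linv l) = winv (@linv n') (sub l)).
Proof.
move=> gen'; have [f fP] := boolp.choice (fun i => gen' (gens i)).
exists (fun l => if l.2 then winv (@linv n') (f l.1) else f l.1); split.
  by case=> i [] /=; rewrite ?weval_winv fP mulg1.
case=> i [] //=; rewrite /winv map_rev revK -map_comp map_id_in //.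
by case=> j b _; rewrite /linv /= negbK.
Qed.

Lemma word_problem_computable n (gens : 'I_n -> G) :
  decidable_word_problem G ->
  exists W : pred (seq nat), computable W /\
    forall w : word n, W (map (@code_letter n) w) = `[< weval gens w = 1%g >].
Proof.
case=> n' [gens' [gen' [f fP]]].
have [sub [subP _]] := word_substitution gens gen'.
have [tbl tblP] := letter_table [::] sub.
(* The predicate has to be decided on every list of numbers: one that codes no letter lies beyond
   the table and reads as the empty word. *)
pose ws (s : seq nat) := flatten (map (nth [::] tbl) s).
exists (fun s => `[< weval gens' (ws s) = 1%g >]); split; last first.
  move=> w; rewrite /ws -map_comp (eq_map (g := sub)).
    by rewrite (weval_flatten _ subP).
  by move=> l /=; rewrite tblP.
have [g gP] : computable (fun s => map (@code_letter n') (ws s)).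
  apply: (eq_computable (F := fun s =>
     flatten (map (nth [::] (map (map (@code_letter n')) tbl)) s))).
    move=> s; rewrite /ws map_flatten -map_comp; congr flatten.
    apply: eq_map => c /=; case: (ltnP c (size tbl)) => lt_c.
      by rewrite (nth_map [::]).
    by rewrite !nth_default ?size_map.
  apply: computable_flatten; apply: computable_map; last exact: computable_id.
  apply: computable_nth; computable_tac.
exists (MComp f [:: g]) => s; exists [:: code_word (ws s)].
  by split=> //; have := gP s; rewrite /= code_seq_map.
have [b [bP eqb]] := fP (ws s).
suff -> : `[< weval gens' (ws s) = 1%g >] = b by [].
by apply/asboolP/idP => /eqb.
Qed.

(** The size [k] is read off the input as its number of rows, so one algorithm serves all sizes;
    [kG] and the solution of the word problem are built into it. *)
Lemma kernel_test_algorithm n (gens : 'I_n -> G) (kG : nat) :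
  decidable_word_problem G ->
  exists f : murec, forall k (M : 'M[formal n]_k),
    mueval f [:: code_matrix M]
      (kernel_test (@linv n) kG (fun w => `[< weval gens w = 1%g >])
                   (enum 'I_k) (entries M)).
Proof.
move=> /(word_problem_computable gens)[W [Wcomp WP]].
have [f fP] : computable (fun D => kernel_test code_linv kG W
                                  (iota 0 (size D)) (smatrix_of_rows D)).
  apply: computable_kernel_test => //.
  - by rewrite /code_linv; computable_tac.
  - by computable_tac.
  - rewrite /smatrix_of_rows; computable_tac.
exists f => k M; rewrite -enc_code_rows.
have := fP (code_rows M); rewrite -smap_entries [size _](size_map _).
rewrite size_enum_ord -val_enum_ord.
by rewrite (kernel_test_smap val_inj (@code_letter_linv n) _ _ _ WP).
Qed.

End WordProblem.

(** * Finite partial actions of sofic groups *)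

Section PartialAction.
Variables (V : eqType) (n : nat) (step : V -> letter n -> option V).

Fixpoint follow (v : V) (w : word n) : option V :=
  if w is l :: w' then obind (follow^~ w') (step v l) else Some v.

Lemma follow_cat v w w' : follow v (w ++ w') = obind (follow^~ w') (follow v w).
Proof. by elim: w v => //= l w IHw v; case: (step v l) => //= u;
  rewrite IHw. Qed.

(** Each letter acts as a partial bijection whose inverse is the action of the inverse letter. This
    is what turns the formal adjoint into the transpose of an integer matrix. *)
Definition invertible_step : Prop :=
  forall v l u, (step v l == Some u) = (step u (linv l) == Some v).

Lemma follow_winv v w u : invertible_step ->
  (follow v w == Some u) = (follow u (winv (@linv n) w) == Some v).
Proof.
move=> stepV; rewrite /winv; elim: w v u => [|l w IHw] v u /=.
  by rewrite !(inj_eq Some_inj) eq_sym.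
rewrite rev_cons -cats1 follow_cat /=.
apply/eqP/eqP.
  case El: (step v l) => [x|] //= /eqP; rewrite IHw => /eqP -> /=.
  by have /eqP -> : step x (linv l) == Some v by rewrite -stepV El.
case Ew: (follow u (rev _)) => [x|] //=.
case Ex: (step x (linv l)) => [y|] //= [yv].
have /eqP -> /= : step v l == Some x by rewrite stepV Ex yv.
by apply/eqP; rewrite IHw Ew.
Qed.

End PartialAction.

Lemma follow_flatten (V : eqType) n n' (step : V -> letter n' -> option V)
    (sub : letter n -> word n') v w :
  follow (fun u l => follow step u (sub l)) v w =
  follow step v (flatten (map sub w)).
Proof.
elim: w v => //= l w IHw v; rewrite follow_cat.
by case: (follow step v (sub l)) => //= u.
Qed.

Section GraphAction.
Variables (G : groupType) (n : nat) (g : 'I_n -> G).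
Variables (V : finType) (e : V -> 'I_n -> V -> bool).

Definition edge_step (v : V) (l : letter n) : option V :=
  [pick w | if l.2 then e w l.1 v else e v l.1 w].

Lemma edge_stepP v l w : admissible g e ->
  (edge_step v l == Some w) = if l.2 then e w l.1 v else e v l.1 w.
Proof.
case=> deg _; rewrite /edge_step; case: pickP => [u uP|none]; last first.
  by rewrite none.
apply/eqP/idP => [[<-] //|wP]; congr Some.
have [_ _ /(_ l.1)[/card_le1_eqP out1 /card_le1_eqP in1]] := deg v.
by case: l.2 uP wP => uP wP; [apply: in1 | apply: out1].
Qed.

Lemma edge_step_invertible : admissible g e -> invertible_step edge_step.
Proof.
by move=> adm v l u; rewrite !edge_stepP // /linv /=; case: l.2.
Qed.

Lemma gball_le (T : Type) (f : T -> 'I_n -> T -> bool) v r s :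
  r <= s -> gball f v r `<=` gball f v s.
Proof.
move=> /subnK <-; elim: (s - r) => [|m IHm] u //= /IHm ?; by left.
Qed.

Lemma gball_cayley_translate c a r x :
  gball (cayley g) a r x -> gball (cayley g) (c * a)%g r (c * x)%g.
Proof.
elim: r x => [|r IHr] x /=; first by move=> ->.
case=> [/IHr|[u /IHr ur [i ei]]]; first by left.
right; exists (c * u)%g => //; exists i.
move: ei; rewrite /cayley -!mulgA !(can_eq (mulKg c)).
by [].
Qed.

Lemma gball_weval (w : word n) : gball (cayley g) 1%g (size w) (weval g w).
Proof.
elim/last_ind: w => //= w l IHw; rewrite size_rcons /=; right.
exists (weval g w) => //; exists l.1; rewrite /cayley -cats1 weval_cat /= mulg1.
by case: l.2; rewrite ?eqxx // mulgVK eqxx orbT.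
Qed.

Variables (v : V) (r : nat) (phi : V -> G).
Hypotheses (adm : admissible g e)
  (phi_bij : set_bij (gball e v r) (gball (cayley g) 1%g r) phi)
  (phi_edge : forall u i w, gball e v r u -> gball e v r w ->
     e u i w = cayley g (phi u) i (phi w)).

Let phi_inj u w : gball e v r u -> gball e v r w -> phi u = phi w -> u = w.
Proof.
by case: phi_bij => _ inj _ uB wB; apply: inj; rewrite inE.
Qed.

Let ball_center : gball e v r v.
Proof. by apply: (@gball_le _ _ _ 0 r) => //. Qed.

Let phi_ball s u : s <= r -> gball e v s u ->
  gball (cayley g) (phi v) s (phi u).
Proof.
elim: s u => [|s IHs] u le_sr /=; first by move=> ->.
case=> [uB|[x xB [i xi]]]; first by left; apply: IHs => //; exact: ltnW.
right; exists (phi x); first by apply: IHs => //; exact: ltnW.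
have xB' : gball e v r x by apply: gball_le xB; exact: ltnW.
have uB' : gball e v r u.
  by apply: (gball_le le_sr); right; exists x => //; exists i.
by exists i; rewrite -!phi_edge.
Qed.

(* The isomorphism need not send v to 1, but B(1, r) is contained in
   B(phi v, r) = phi v B(1, r), hence equal to it since both are finite. *)
Let ball_translate x :
  gball (cayley g) 1%g r x -> gball (cayley g) 1%g r (phi v * x)%g.
Proof.
case: (phi_bij) => homo _ surj.
have back u : exists p, gball e v r u ->
    gball e v r p /\ phi p = ((phi v)^-1 * phi u)%g.
  have [uB|nB] := pselect (gball e v r u); last by exists v.
  have := phi_ball (leqnn r) uB => /(gball_cayley_translate (phi v)^-1%g).
  by rewrite mulVg => /surj[p pB <-]; exists p.
(* [psi] is the left translation by the inverse of [phi v], pulled back to the graph along [phi]. It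
   is an injective self-map of a finite ball, hence onto. *)
have [psi psiP] := boolp.choice back.
pose B : {set V} := finset.finset [pred u | `[< gball e v r u >]].
have BP u : (u \in B) = `[< gball e v r u >] by rewrite finset.in_set.
have psiB : psi @: B = B.
  apply/eqP; rewrite eqEcard card_in_imset ?leqnn ?andbT; last first.
    move=> u w /[!BP] /asboolP uB /asboolP wB psiE.
    have [[_ pu] [_ pw]] := (psiP _ uB, psiP _ wB).
    by apply: phi_inj => //; apply: (mulgI (phi v)^-1%g); rewrite -pu -pw psiE.
  apply/fintype.subsetP => _ /imsetP[u /[!BP] /asboolP uB ->].
  by apply/asboolP; case: (psiP _ uB).
move=> /surj[p pB <-].
have : p \in psi @: B by rewrite psiB BP; apply/asboolP.
case/imsetP => u /[!BP] /asboolP uB ->.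
by have [_ ->] := psiP _ uB; rewrite mulVKg; apply: homo.
Qed.

(** The endpoint predicted by the Cayley diagram lies in B(1, r) by [ball_translate], so it comes
    from a vertex [q] of the ball. The isomorphism then supplies the edge to [q], and admissibility
    makes it the one that [edge_step] picks. *)
Lemma follow_ball (w : word n) : size w <= r ->
  exists p, [/\ follow edge_step v w = Some p, gball e v (size w) p &
                phi p = (phi v * weval g w)%g].
Proof.
elim/last_ind: w => [|w l IHw]; first by exists v; rewrite /= mulg1.
rewrite size_rcons => le_wr.
have [p [wp pB pE]] := IHw (ltnW le_wr).
case: (phi_bij) => _ _ surj.
have: gball (cayley g) 1%g r (phi v * weval g (rcons w l))%g.
  apply: ball_translate; apply: (@gball_le _ _ _ (size (rcons w l))).
    by rewrite size_rcons.
  exact: gball_weval.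
move=> /surj[q qB qE]; exists q.
have pB' : gball e v r p by apply: gball_le pB; exact: ltnW.
have lE : if l.2 then e q l.1 p else e p l.1 q.
  rewrite !phi_edge // qE pE /cayley -cats1 weval_cat /= mulg1.
  by case: l.2; rewrite !mulgA ?mulgVK.
split=> //.
- by rewrite -cats1 follow_cat wp /=; have /eqP -> : edge_step p l == Some q
    by rewrite edge_stepP.
- right; exists p => //; exists l.1; move: lE.
  by case: l.2 => ->; rewrite ?orbT.
Qed.

Lemma follow_eq_center (w : word n) : size w <= r ->
  follow edge_step v w = Some v <-> weval g w = 1%g.
Proof.
move=> le_wr; have [p [-> pB pE]] := follow_ball le_wr.
split=> [[pv]|w1].
  by apply: (mulgI (phi v)); rewrite mulg1 -pE pv.
by congr Some; apply: phi_inj; rewrite ?pE ?w1 ?mulg1 //; apply: gball_le pB.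
Qed.

End GraphAction.

Lemma sofic_action (R : realType) (G : groupType) n (gens : 'I_n -> G)
    (L : nat) (eps : R) :
  sofic R G -> (0 < eps)%R ->
  exists (V : finType) (step : V -> letter n -> option V),
    [/\ 0 < #|V|, invertible_step step &
      ((1 - eps) * #|V|%:R <= #|[pred v : V | `[< forall w : word n,
         (size w <= L)%N -> follow step v w = Some v <-> weval gens w = 1%g
           >]]|%:R)%R].
Proof.
case=> n' [g [_ gen approx]] eps_gt0.
have [sub [subP subV]] := word_substitution gens gen.
pose s := \max_(l : letter n) size (sub l).
(* The approximations are given for the family [g]: a word of length at most [L] in [gens] becomes
   one of length at most [L * s] in [g]. The successor keeps the radius positive. *)
have [V [e [V_gt0 [adm cardV]]]] := approx eps (L * s).+1%N eps_gt0 isT.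
exists V, (fun v l => follow (edge_step e) v (sub l)); split=> //.
  by move=> v l u; rewrite subV -(follow_winv _ _ _ (edge_step_invertible adm)).
apply: (le_trans cardV); rewrite ler_nat; apply: subset_leq_card.
apply/fintype.subsetP => v; rewrite !inE => -[phi [phi_bij phi_edge]] w le_wL.
rewrite follow_flatten -(weval_flatten _ subP).
apply: (follow_eq_center adm phi_bij phi_edge).
apply: leqW; rewrite size_flatten /shape -map_comp sumnE big_map.
apply: (@leq_trans (\sum_(l <- w) s)).
  by apply: leq_sum => l _; apply: (leq_bigmax l).
by rewrite big_const_seq iter_addn_0 count_predT mulnC leq_mul2r le_wL orbT.
Qed.

Local Open Scope ring_scope.

(** * Small eigenvalues of integer Gram matrices *)

Section DiagonalizedMatrix.
Variables (F : fieldType) (d : nat) (P : 'M[F]_d) (l : 'rV[F]_d).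
Hypothesis P_unit : P \in unitmx.
Let A := invmx P *m diag_mx l *m P.

Lemma char_poly_diagonalized : char_poly A = \prod_i ('X - (l 0 i)%:P).
Proof.
have charE : char_poly_mx A =
    map_mx polyC (invmx P) *m char_poly_mx (diag_mx l) *m map_mx polyC P.
  rewrite /char_poly_mx mulmxBr mulmxBl -!map_mxM /= -/A; congr (_ - _).
  rewrite mul_mx_scalar -scalemxAl -map_mxM /= mulVmx // map_mx1.
  by rewrite scalemx1.
rewrite /char_poly charE !det_mulmx mulrAC -det_mulmx -map_mxM mulVmx //
  map_mx1.
rewrite det1 mul1r -/(char_poly _) char_poly_trig ?diag_mx_is_trig //.
by apply: eq_bigr => i _; rewrite mxE eqxx mulr1n.
Qed.

Lemma trace_iter_diagonalized c m :
  \tr (iter m (mulmx (c%:M - A)) 1%:M) = \sum_i (c - l 0 i) ^+ m.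
Proof.
pose D := \row_i (c - l 0 i).
have AE : c%:M - A = invmx P *m diag_mx D *m P.
  have -> : diag_mx D = c%:M - diag_mx l.
    by apply/matrixP => i j; rewrite !mxE -mulrnBl.
  by rewrite mulmxBr mulmxBl mul_mx_scalar -scalemxAl mulVmx // scalemx1.
have -> : iter m (mulmx (c%:M - A)) 1%:M =
          invmx P *m diag_mx (\row_i (c - l 0 i) ^+ m) *m P.
  elim: m => [|m IHm] /=.
    have -> : diag_mx (\row_i (c - l 0 i) ^+ 0) = 1%:M :> 'M[F]_d.
      by apply/matrixP => i j; rewrite !mxE expr0.
    by rewrite mulmx1 mulVmx.
  rewrite IHm AE !mulmxA mulmxK //; congr (_ *m _); rewrite -!mulmxA mulmx_diag.
  by congr (_ *m diag_mx _); apply/rowP => i; rewrite !mxE exprS.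
rewrite mxtrace_mulC mulmxA mulmxV // mul1mx mxtrace_diag.
by apply: eq_bigr => i _; rewrite mxE.
Qed.

End DiagonalizedMatrix.

Section SpectralGap.
Local Open Scope sesquilinear_scope.
Variables (F : numClosedFieldType) (d : nat) (N : 'M[int]_d) (C : nat).
Let B := N^T *m N.
Hypothesis C_ge2 : (2 <= C)%N.
Hypothesis B_bound : forall i, (\sum_j `|B i j|%N <= C)%N.

Let BF : 'M[F]_d := map_mx intr B.
Let P := spectralmx BF.
Let l := spectral_diag BF.

Let BF_spectral : BF = invmx P *m diag_mx l *m P.
Proof.
apply/orthomx_spectralP/symmetric_normalmx.
  apply/is_hermitianmxP; rewrite expr0 scale1r map_mx_id //.
  by rewrite /BF map_trmx /B trmx_mul trmxK.
by apply/mxOverP => i j; rewrite mxE realz.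
Qed.

Let P_unit : P \in unitmx. Proof. exact: spectral_unit. Qed.

Let eigenrow i : row i P *m BF = l 0 i *: row i P.
Proof.
rewrite BF_spectral -row_mul !mulmxA mulmxV // mul1mx.
by rewrite row_mul row_diag_mx -scalemxAl -rowE.
Qed.

Let row_norm i : row i P *m (row i P)^t* = 1%:M.
Proof.
apply/rowP => j; rewrite ord1.
have /unitarymxP/matrixP/(_ i i) := spectral_unitarymx BF.
rewrite !mxE eqxx => <-; apply: eq_bigr => k _.
by rewrite !mxE.
Qed.

(** The rows of [P] are unit eigenvectors, so the eigenvalue is the squared norm of the image of
    such a row under N^T. *)
Let l_ge0 i : 0 <= l 0 i.
Proof.
pose u := row i P *m (map_mx intr N)^T.
have -> : l 0 i = (u *m u^t*) 0 0.
  have -> : l 0 i = (row i P *m BF *m (row i P)^t* ) 0 0.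
    by rewrite eigenrow -scalemxAl row_norm !mxE mulr1.
  apply: (congr1 (fun M : 'M_1 => M 0 0)).
  have -> : u^t* = map_mx intr N *m (row i P)^t*.
    rewrite /u trmx_mul trmxK map_mxM; congr (_ *m _).
    by apply/matrixP => a b; rewrite !mxE rmorph_int.
  by rewrite /BF /B map_mxM /u map_trmx !mulmxA.
by rewrite mxE sumr_ge0 // => j _; rewrite !mxE mul_conjC_ge0.
Qed.

(** Taking the l^1 norm of both sides of v B = l v for an eigenvector v bounds l by the largest
    absolute row sum of B. *)
Let l_leC i : l 0 i <= C%:R.
Proof.
pose v := row i P.
pose s := \sum_j `|v 0 j|.
have s_ge0 : 0 <= s by apply: sumr_ge0.
have s_gt0 : 0 < s.
  rewrite lt_neqAle s_ge0 andbT eq_sym; apply/eqP => s0.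
  have v0 j : `|v 0 j| = 0 by apply: (psumr_eq0P _ s0).
  have := row_norm i; have -> : row i P = 0.
    by apply/rowP => j; apply/eqP; rewrite [X in _ == X]mxE -normr_eq0 -/v v0.
  by rewrite mul0mx => /matrixP/(_ 0 0)/eqP; rewrite !mxE eq_sym oner_eq0.
rewrite -(ler_pM2r s_gt0) -[l 0 i]ger0_norm //.
rewrite {1}/s mulr_sumr.
have le1 j : `|l 0 i| * `|v 0 j| <= \sum_k `|v 0 k| * `|BF k j|.
  rewrite -normrM; have /rowP/(_ j) := eigenrow i.
  rewrite -/v [RHS]mxE => <-; rewrite mxE (le_trans (ler_norm_sum _ _ _)) //.
  by apply: ler_sum => k _; rewrite normrM.
apply: (le_trans (ler_sum _ (fun j _ => le1 j))).
rewrite exchange_big /= mulr_sumr; apply: ler_sum => k _.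
rewrite -mulr_sumr mulrC ler_wpM2r //.
rewrite (eq_bigr (fun j => (`|B k j|%N)%:R)); last first.
  by move=> j _; rewrite mxE -intr_norm -natr_absz.
by rewrite -natr_sum ler_nat.
Qed.

(** Up to sign this product is the coefficient of X^r in the characteristic polynomial of [B], where
    r is the multiplicity of the eigenvalue 0. That coefficient is an integer, and the product is
    positive. *)
Let prod_nonzero_ge1 : 1 <= \prod_(i | l 0 i != 0) l 0 i.
Proof.
have charE : map_poly intr (char_poly B) = \prod_i ('X - (l 0 i)%:P).
  by rewrite map_char_poly -/BF BF_spectral char_poly_diagonalized.
pose r := #|[pred i | l 0 i == 0]|.
have : \prod_i ('X - (l 0 i)%:P) = 'X^r * \prod_(i | l 0 i != 0)
  ('X - (l 0 i)%:P).
  rewrite (bigID (fun i => l 0 i == 0)) /=; congr (_ * _).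
  rewrite (eq_bigr (fun=> 'X)) ?prodr_const // => i /eqP ->.
  by rewrite subr0.
rewrite -charE => /(congr1 (fun p : {poly F} => `|p`_r|)).
rewrite coef_map /= coefXnM ltnn subnn -horner_coef0 horner_prod normr_prod.
rewrite (eq_bigr (fun i => l 0 i)); last first.
  by move=> i _; rewrite hornerXsubC sub0r normrN ger0_norm.
move=> prodE; have prod_gt0 : 0 < \prod_(i | l 0 i != 0) l 0 i.
  by apply: prodr_gt0 => i li; rewrite lt_neqAle eq_sym li l_ge0.
rewrite -prodE -intr_norm; rewrite -prodE normr_gt0 intr_eq0 in prod_gt0.
by rewrite -[1]/(1%:~R) ler_int; lia.
Qed.

(** In the product of the nonzero eigenvalues, each factor counted here is at most C^-q and the
    others are at most C. As the product is at least 1, C^(q s) <= C^d for the number s of small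
    factors. *)
Let card_small q : (0 < q)%N ->
  (q * #|[pred i | ((l 0 i != 0) && (l 0 i * C%:R ^+ q <= 1))%R]| <= d)%N.
Proof.
move=> q_gt0; set S := [pred i | _].
have C_gt1 : 1 < C%:R :> F by rewrite ltr1n.
have C_gt0 : 0 < C%:R :> F by rewrite ltr0n; lia.
have le1 : 1 <= \prod_i (if S i then (C%:R ^+ q)^-1 else C%:R) :> F.
  apply: (le_trans prod_nonzero_ge1); rewrite [leLHS]big_mkcond /=.
  apply: ler_prod => i _; rewrite /S /=; case: eqVneq => [->|li] /=.
    by rewrite ler01 ler1n; lia.
  rewrite l_ge0 /=; case: ifP => // small.
  by rewrite -[leRHS]mul1r ler_pdivlMr // exprn_gt0.
have : C%:R ^+ (q * #|S|) <= C%:R ^+ d :> F.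
  rewrite (bigID S) /= in le1.
  rewrite (eq_bigr (fun=> (C%:R ^+ q)^-1)) in le1; last by move=> i ->.
  rewrite [X in _ <= _ * X](eq_bigr (fun=> C%:R)) in le1; last first.
    by move=> i /negPf ->.
  rewrite !prodr_const exprVn -exprM ler_pdivlMl ?exprn_gt0 // mulr1 in le1.
  apply: (le_trans le1); apply: ler_weXn2l; first exact: ltW.
  by rewrite -[leqRHS]card_ord max_card.
by rewrite ler_eXn2l.
Qed.

(** By Bernoulli's inequality the left side is at most (1 - x)^m (1 + x)^m = (1 - x^2)^m. It is used
    for x = l / C >= C^-(q+1), where m x >= q and the power is therefore at most 1/(q+1). *)
Lemma bernoulli_inv (x : F) m : 0 <= x <= 1 ->
  (1 - x) ^+ m * (1 + m%:R * x) <= 1.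
Proof.
move=> /andP[x_ge0 x_le1].
have bern : 1 + m%:R * x <= (1 + x) ^+ m.
  elim: m => [|m IHm]; first by rewrite mul0r addr0 expr0.
  rewrite exprS (le_trans _ (ler_wpM2l _ IHm)) ?addr_ge0 //.
  rewrite -natr1 -subr_ge0.
  have -> : (1 + x) * (1 + m%:R * x) - (1 + (m%:R + 1) * x)
    = m%:R * x ^+ 2 by ring.
  by rewrite mulr_ge0 // exprn_ge0.
apply: (le_trans (ler_wpM2l _ bern)); first by rewrite exprn_ge0 ?subr_ge0.
rewrite -exprMn exprn_ile1 //.
  by rewrite mulr_ge0 ?subr_ge0 // addr_ge0.
have -> : (1 - x) * (1 + x) = 1 - x ^+ 2 by ring.
by rewrite lerBlDr lerDl exprn_ge0.
Qed.

(** The estimate holds eigenvalue by eigenvalue; an eigenvalue 0 contributes 1 to both sides. A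
    second power stands in for the dimension of the kernel because traces, unlike kernels, can be
    compared between a graph and the group. *)
Lemma spectral_gap q m m' : (0 < q)%N -> (q * C ^ q.+1 <= m)%N ->
  (\tr (iter m (mulmx (C%:Z%:M - B)) 1%:M))%:~R / C%:R ^+ m <=
  (\tr (iter m' (mulmx (C%:Z%:M - B)) 1%:M))%:~R / C%:R ^+ m' +
    d%:R * (q%:R^-1 + q.+1%:R^-1) :> F.
Proof.
move=> q_gt0 le_m.
have C_gt0 : 0 < C%:R :> F by rewrite ltr0n; lia.
have trE k : (\tr (iter k (mulmx (C%:Z%:M - B)) 1%:M))%:~R / C%:R ^+ k =
    \sum_i (1 - l 0 i / C%:R) ^+ k.
  have -> : (\tr (iter k (mulmx (C%:Z%:M - B)) 1%:M))%:~R =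
            \tr (iter k (mulmx (C%:R%:M - BF)) 1%:M) :> F.
    rewrite -[LHS]/(intr _) -trace_map_mx; congr (\tr _).
    elim: k => [|k IHk] /=; first by rewrite map_mx1.
    by rewrite map_mxM IHk /= map_mxB map_scalar_mx.
  rewrite BF_spectral trace_iter_diagonalized // mulr_suml.
  apply: eq_bigr => i _; rewrite -expr_div_n mulrBl divff //.
  exact: lt0r_neq0.
rewrite !trE; pose S := [pred i | (l 0 i != 0) && (l 0 i * C%:R ^+ q <= 1)].
have s01 i : 0 <= 1 - l 0 i / C%:R <= 1.
  rewrite subr_ge0 ler_pdivrMr // mul1r l_leC /= lerBlDr lerDl.
  by rewrite divr_ge0 // ltW.
have le1 i : (1 - l 0 i / C%:R) ^+ m <= (1 - l 0 i / C%:R) ^+ m' +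
             ((S i)%:R + q.+1%:R^-1).
  have /andP[s_ge0 s_le1] := s01 i.
  case: (eqVneq (l 0 i) 0) => [->|li].
    by rewrite mul0r subr0 !expr1n lerDl addr_ge0 ?invr_ge0 ?ler0n.
  case: (boolP (S i)) => [_|].
    by rewrite (le_trans (exprn_ile1 m s_ge0 s_le1))
      // addrCA lerDl addr_ge0 ?invr_ge0 ?ler0n // exprn_ge0.
  rewrite /S /= li /= => big; rewrite add0r -[leLHS]add0r lerD ?exprn_ge0 //.
  have {}big : 1 <= l 0 i * C%:R ^+ q.
    rewrite real_leNgt ?real1 //;
      last by rewrite ger0_real // mulr_ge0 // exprn_ge0 // ltW.
    by apply: contra big => /ltW.
  have x01 : 0 <= l 0 i / C%:R <= 1.
    by rewrite divr_ge0 ?ler0n //= ler_pdivrMr // mul1r l_leC.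
  have pos : 0 < 1 + m%:R * (l 0 i / C%:R).
    by rewrite ltr_pwDl // mulr_ge0 ?ler0n //; case/andP: x01.
  have := bernoulli_inv m x01; rewrite -ler_pdivlMr // => /le_trans -> //.
  rewrite div1r lef_pV2 ?posrE ?ltr0n //.
  rewrite -natr1 addrC lerD2l.
  have le2 : (q * C ^ q.+1)%:R <= m%:R :> F by rewrite ler_nat.
  apply: le_trans (ler_wpM2r _ le2); last by case/andP: x01.
  rewrite natrM natrX -[leLHS]mulr1 -mulrA ler_wpM2l //.
  by rewrite exprSr -mulrA (mulrCA C%:R) divff ?lt0r_neq0 // mulr1 mulrC.
apply: (le_trans (ler_sum _ (fun i _ => le1 i))).
rewrite big_split /= lerD2l big_split /= mulrDr lerD //; last first.
  by rewrite sumr_const card_ord mulr_natl.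
have -> : \sum_i (S i)%:R = #|S|%:R :> F.
  rewrite -sum1_card natr_sum [RHS]big_mkcond /=; apply: eq_bigr => i _.
  by rewrite [i \in S]inE; case: (_ && _).
rewrite ler_pdivlMr ?ltr0n // -natrM ler_nat mulnC.
exact: card_small.
Qed.

End SpectralGap.

(** * Sums over the group *)

Section RealSums.
Variables (R : realType) (G : groupType).
Implicit Types f g : G -> R.

(** Bounding the sums over duplicate-free lists turns comparisons into finite computations;
    [rsummableP] links this to sums in the extended reals. *)
Definition dominated f (B : R) : Prop :=
  forall s : seq G, uniq s -> \sum_(x <- s) `|f x| <= B.

Definition rsummable f : Prop := exists B, dominated f B.

Lemma esum_leP f B : (forall x, 0 <= f x) ->
  (forall s : seq G, uniq s -> \sum_(x <- s) f x <= B) <->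
  (\esum_(x in [set: G]) (f x)%:E <= B%:E)%E.
Proof.
move=> f_ge0; split=> [fB|fB s s_uniq].
  apply: ge_ereal_sup => _ [A [finA _] <-].
  rewrite fsbig_finite //= sumEFin lee_fin; apply: fB.
  exact: fset_uniq.
rewrite -lee_fin -sumEFin; apply: le_trans fB; apply: esum_ge.
exists [set` s]; first by split=> //; exact: finite_seq.
rewrite fsbig_finite ?finite_seq //=.
rewrite (perm_big (fset_set [set` s])) //.
rewrite uniq_perm ?fset_uniq // => x.
rewrite in_fset_set; last exact: finite_seq.
by rewrite mem_setE.
Qed.

Lemma rsummableP f :
  rsummable f <-> (\esum_(x in [set: G]) (`|f x|)%:E < +oo)%E.
Proof.
split=> [[B /(esum_leP B (fun x => normr_ge0 (f x))) fB]|].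
  exact: le_lt_trans fB (ltry _).
have : (0 <= \esum_(x in [set: G]) (`|f x|)%:E)%E.
  by apply: esum_ge0 => x _; rewrite lee_fin.
case E: (esum _ _) => [B| |] // _ _; exists B.
by apply/(esum_leP B (fun x => normr_ge0 (f x))); rewrite E.
Qed.

Lemma dominated_le f g B : (forall x, `|f x| <= `|g x|) -> dominated g B ->
  dominated f B.
Proof. by move=> fg gB s s_uniq; apply: le_trans (gB s s_uniq);
  apply: ler_sum. Qed.

Lemma rsummable_le f g : (forall x, `|f x| <= `|g x|) -> rsummable g ->
  rsummable f.
Proof. by move=> fg [B gB]; exists B; apply: dominated_le gB. Qed.

Lemma rsummableD f g : rsummable f -> rsummable g ->
  rsummable (fun x => f x + g x).
Proof.
move=> [B fB] [B' gB]; exists (B + B') => s s_uniq.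
apply: (@le_trans _ _ (\sum_(x <- s) (`|f x| + `|g x|))).
  by apply: ler_sum => x _; exact: ler_normD.
by rewrite big_split lerD ?fB ?gB.
Qed.

Lemma rsummableZ c f : rsummable f -> rsummable (fun x => c * f x).
Proof.
move=> [B fB]; exists (`|c| * B) => s s_uniq.
rewrite (eq_bigr (fun x => `|c| * `|f x|)); last by move=> x _; rewrite normrM.
by rewrite -mulr_sumr ler_wpM2l ?fB.
Qed.

Definition nnsum f : R := fine (\esum_(x in [set: G]) (f x)%:E).

Lemma esum_fin_num f : rsummable f -> (forall x, 0 <= f x) ->
  \esum_(x in [set: G]) (f x)%:E \is a fin_num.
Proof.
move=> /rsummableP fS f_ge0; rewrite ge0_fin_numE; last first.
  by apply: esum_ge0 => x _; rewrite lee_fin.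
rewrite (eq_esum (b := fun x => (`|f x|)%:E)) // => x _.
by rewrite ger0_norm.
Qed.

Lemma nnsum_leP f B : rsummable f -> (forall x, 0 <= f x) ->
  (nnsum f <= B) <-> (forall s : seq G, uniq s -> \sum_(x <- s) f x <= B).
Proof.
move=> fS f_ge0; rewrite esum_leP // -lee_fin fineK //.
exact: esum_fin_num.
Qed.

Lemma nnsumD f g : rsummable f -> rsummable g ->
  (forall x, 0 <= f x) -> (forall x, 0 <= g x) ->
  nnsum (fun x => f x + g x) = nnsum f + nnsum g.
Proof.
move=> fS gS f_ge0 g_ge0; rewrite /nnsum -fineD ?esum_fin_num //.
rewrite -esumD //; last by move=> x _; rewrite lee_fin.
by move=> x _; rewrite lee_fin.
Qed.

(** One inequality holds for every nonnegative factor; applied to c^-1 it gives the other. *)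
Lemma nnsumZ c f : 0 <= c -> rsummable f -> (forall x, 0 <= f x) ->
  nnsum (fun x => c * f x) = c * nnsum f.
Proof.
move=> c_ge0 fS f_ge0.
have half d h : 0 <= d -> rsummable h -> (forall x, 0 <= h x) ->
    nnsum (fun x => d * h x) <= d * nnsum h.
  move=> d_ge0 hS h_ge0; apply/nnsum_leP; first exact: rsummableZ.
    by move=> x; rewrite mulr_ge0.
  move=> s s_uniq; rewrite -mulr_sumr ler_wpM2l //.
  by apply: (nnsum_leP _ hS h_ge0).1.
apply/eqP; rewrite eq_le half //=.
case: (eqVneq c 0) => [->|c_neq0].
  rewrite mul0r /nnsum fine_ge0 // esum_ge0 // => x _.
  by rewrite mul0r.
rewrite -ler_pdivlMl ?lt0r ?c_neq0 // .
rewrite [leLHS](_ : _ = nnsum (fun x => c^-1 * (c * f x))); last first.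
  by congr nnsum; apply/funext => x; rewrite mulKf.
apply: half; rewrite ?invr_ge0 //.
- exact: rsummableZ.
- by move=> x; rewrite mulr_ge0.
Qed.

Definition ppart f := fun x => Num.max (f x) 0.
Definition npart f := fun x => Num.max (- f x) 0.

Lemma rsumE f : rsum f = nnsum (ppart f) - nnsum (npart f).
Proof. by []. Qed.

Lemma ppart_ge0 f x : 0 <= ppart f x. Proof. by rewrite le_max lexx orbT. Qed.
Lemma npart_ge0 f x : 0 <= npart f x. Proof. by rewrite le_max lexx orbT. Qed.

Lemma ppartBnpart f x : f x = ppart f x - npart f x.
Proof.
rewrite /ppart /npart; case: (lerP 0 (f x)) => h.
  by rewrite max_r ?oppr_le0 // subr0.
by rewrite max_l ?oppr_ge0 1?ltW // opprK add0r.
Qed.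

Lemma ppart_rsummable f : rsummable f -> rsummable (ppart f).
Proof.
apply: rsummable_le => x; rewrite ger0_norm ?ppart_ge0 // ge_max.
by rewrite normr_ge0 ler_norm.
Qed.

Lemma npart_rsummable f : rsummable f -> rsummable (npart f).
Proof.
apply: rsummable_le => x; rewrite ger0_norm ?npart_ge0 // ge_max.
by rewrite normr_ge0 -normrN ler_norm.
Qed.

(** The parts of h = f - g need not be f and g, but h^+ + g = h^- + f, and sums of nonnegative
    functions are additive. Linearity of [rsum] rests on this. *)
Lemma rsumB f g : rsummable f -> rsummable g ->
  (forall x, 0 <= f x) -> (forall x, 0 <= g x) ->
  rsum (fun x => f x - g x) = nnsum f - nnsum g.
Proof.
move=> fS gS f_ge0 g_ge0; set h := fun x => _.
have hS : rsummable h.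
  apply: rsummable_le (rsummableD fS gS) => x.
  by rewrite (le_trans (ler_normB _ _)) // !ger0_norm ?addr_ge0.
have [pS nS] := (ppart_rsummable hS, npart_rsummable hS).
have: nnsum (fun x => ppart h x + g x) = nnsum (fun x => npart h x + f x).
  rewrite /nnsum; congr fine; apply: eq_esum => x _; congr EFin.
  by have := ppartBnpart h x; rewrite /h; lra.
rewrite !nnsumD //; try exact: ppart_ge0; try exact: npart_ge0.
by rewrite rsumE; lra.
Qed.

Lemma eq_rsum f g : f =1 g -> rsum f = rsum g.
Proof. by move=> /funext ->. Qed.

Lemma rsumD f g : rsummable f -> rsummable g ->
  rsum (fun x => f x + g x) = rsum f + rsum g.
Proof.
move=> fS gS; have [pf nf] := (ppart_rsummable fS, npart_rsummable fS).
have [pg ng] := (ppart_rsummable gS, npart_rsummable gS).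
rewrite (eq_rsum (g := fun x =>
  (ppart f x + ppart g x) - (npart f x + npart g x))).
  rewrite rsumB ?nnsumD //; try exact: rsummableD;
  try by move=> x; rewrite ?addr_ge0 ?ppart_ge0 ?npart_ge0.
  by rewrite !rsumE; lra.
by move=> x; rewrite [in LHS](ppartBnpart f) [in LHS](ppartBnpart g); lra.
Qed.

Lemma nnsum_rsum f : (forall x, 0 <= f x) -> rsum f = nnsum f.
Proof.
move=> f_ge0; rewrite rsumE (_ : ppart f = f); last first.
  by apply/funext => x; rewrite /ppart max_l.
rewrite (_ : npart f = fun=> 0); last first.
  by apply/funext => x; rewrite /npart max_r // oppr_le0.
by rewrite [X in _ - X]/nnsum esum1 // subr0.
Qed.

Lemma rsumN f : rsum (fun x => - f x) = - rsum f.
Proof.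
rewrite !rsumE opprB; congr (_ - nnsum _).
by apply/funext => x; rewrite /npart /ppart opprK.
Qed.

Lemma rsumZ c f : rsummable f -> rsum (fun x => c * f x) = c * rsum f.
Proof.
move=> fS.
have pos d : 0 <= d -> rsum (fun x => d * f x) = d * rsum f.
  move=> d_ge0; have [pf nf] := (ppart_rsummable fS, npart_rsummable fS).
  rewrite (eq_rsum (g := fun x => d * ppart f x - d * npart f x)).
    rewrite rsumB ?nnsumZ //; try exact: rsummableZ;
    try by move=> x; rewrite ?mulr_ge0 ?ppart_ge0 ?npart_ge0.
    by rewrite rsumE mulrBr.
  by move=> x; rewrite [in LHS](ppartBnpart f) mulrBr.
case: (lerP 0 c) => [/pos //|c_lt0].
rewrite (eq_rsum (g := fun x => - (- c * f x))); last by move=> x;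
  rewrite mulNr opprK.
by rewrite rsumN pos ?oppr_ge0 1?ltW // mulNr opprK.
Qed.

Lemma rsum_ge0 f : (forall x, 0 <= f x) -> 0 <= rsum f.
Proof.
by move=> f_ge0; rewrite nnsum_rsum // fine_ge0 // esum_ge0 // => x _;
  rewrite lee_fin.
Qed.

Lemma rsum_leP f B : rsummable f -> (forall x, 0 <= f x) ->
  (rsum f <= B) <-> (forall s : seq G, uniq s -> \sum_(x <- s) f x <= B).
Proof. by move=> fS f_ge0; rewrite nnsum_rsum // nnsum_leP. Qed.

Lemma le_rsum f x : rsummable f -> (forall x, 0 <= f x) -> f x <= rsum f.
Proof.
move=> fS f_ge0; have /(rsum_leP _ fS f_ge0)/(_ [:: x] isT) := lexx (rsum f).
by rewrite big_seq1.
Qed.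

Lemma nnsum_translate f c : nnsum (fun x => f (c * x)%g) = nnsum f.
Proof.
rewrite /nnsum; congr fine; apply/esym.
apply: (@reindex_esum _ _ _ _ _ (fun x => (c * x)%g) (fun x => (f x)%:E)).
split=> [x|x y _ _ /mulgI|x _] //.
by exists (c^-1 * x)%g => //; rewrite mulVKg.
Qed.

Lemma rsum_translate f c : rsum (fun x => f (c * x)%g) = rsum f.
Proof.
by rewrite !rsumE -(nnsum_translate (ppart f) c) -(nnsum_translate (npart f) c).
Qed.

Lemma rsummable_translate f c : rsummable f -> rsummable (fun x => f (c * x)%g).
Proof.
move=> [B fB]; exists B => s s_uniq;
  rewrite -(big_map (fun x => (c * x)%g) xpredT (fun x => `|f x|)).
by apply: fB; rewrite map_inj_uniq //; exact: mulgI.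
Qed.

Lemma rsummable_translater f c : rsummable f ->
  rsummable (fun x => f (x * c)%g).
Proof.
move=> [B fB]; exists B => s s_uniq;
  rewrite -(big_map (fun x => (x * c)%g) xpredT (fun x => `|f x|)).
by apply: fB; rewrite map_inj_uniq //; exact: mulIg.
Qed.

Lemma rsum_at x f : (forall y, y != x -> f y = 0) -> rsum f = f x.
Proof.
have pos h : (forall y, 0 <= h y) -> (forall y, y != x -> h y = 0) ->
  nnsum h = h x.
  move=> h_ge0 h0; rewrite /nnsum (esumID [set x]) //; last first.
    by move=> y _; rewrite lee_fin.
  rewrite setTI setTI esum_set1 ?lee_fin // [X in (_ + X)%E]esum1 ?adde0 //.
  by move=> y /= yx; rewrite h0 //; apply/eqP.
move=> f0; rewrite rsumE !pos; first by rewrite -ppartBnpart.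
- exact: npart_ge0.
- by move=> y yx; rewrite /npart f0 // oppr0 maxxx.
- exact: ppart_ge0.
- by move=> y yx; rewrite /ppart f0 // maxxx.
Qed.

End RealSums.

(** * The projection onto the kernel *)

Lemma discriminant_le (R : realFieldType) (a b c : R) :
  0 <= c -> (forall t, 0 <= a + 2 * t * b + t ^+ 2 * c) -> b ^+ 2 <= a * c.
Proof.
move=> c_ge0 quad; case: (eqVneq c 0) => [c0|c_neq0].
  case: (eqVneq b 0) => [->|b_neq0]; first by rewrite c0 mulr0 expr0n.
  (* For c = 0 the form is affine in t, and this t gives it the value -1. *)
  have := quad (- (a + 1) / (2 * b)); rewrite c0 mulr0 addr0.
  have -> : a + 2 * (- (a + 1) / (2 * b)) * b = - 1 by field.
  by rewrite ler0N1.
have c_gt0 : 0 < c by rewrite lt0r c_neq0.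
have := quad (- b / c).
have -> : a + 2 * (- b / c) * b + (- b / c) ^+ 2 * c = a - b ^+ 2 / c by field.
by rewrite subr_ge0 ler_pdivrMr.
Qed.

Lemma nonincreasing_bounded_cauchy (R : realType) (b : nat -> R) :
  (forall j, b j.+1 <= b j) -> (forall j, 0 <= b j) ->
  forall eps, 0 < eps -> exists N, forall m n, (N <= m)%N -> (N <= n)%N ->
    b m <= b n + eps.
Proof.
move=> b_dec b_ge0 eps eps_gt0.
have dec m n : (m <= n)%N -> b n <= b m.
  by move=> /subnK <-; elim: (n - m)%N => // r IHr;
    exact: le_trans (b_dec _) IHr.
have b_inf : has_inf (range b).
  by split; [exists (b 0), 0 | exists 0 => _ [j _ <-]].
have [_ [N _ <-] lt_N] := inf_adherent eps_gt0 b_inf.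
exists N => m n le_Nm _; apply: (le_trans (dec _ _ le_Nm)); apply: ltW.
apply: (lt_le_trans lt_N); rewrite lerD2r.
by apply: ge_inf; [case: b_inf | exists n].
Qed.

(** * Powers of a symmetric contraction in an inner product space *)

Section PreHilbert.
(** [H] will be square summability inside the space of all functions on the group; [ip] is bilinear
    on [H] only, since a divergent sum has a junk value. *)
Variables (R : realType) (V : lmodType R) (H : V -> Prop) (ip : V -> V -> R).
Hypotheses (HD : forall x y, H x -> H y -> H (x + y))
  (HZ : forall c x, H x -> H (c *: x))
  (ipC : forall x y, ip x y = ip y x)
  (ipDl : forall x y z, H x -> H y -> H z -> ip (x + y) z = ip x z + ip y z)
  (ipZl : forall c x y, H x -> H y -> ip (c *: x) y = c * ip x y)
  (ip_ge0 : forall x, H x -> 0 <= ip x x).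

Lemma H_sub x y : H x -> H y -> H (x - y).
Proof. by move=> Hx Hy; rewrite -scaleN1r; apply/HD/HZ. Qed.

Lemma ipDr x y z : H x -> H y -> H z -> ip z (x + y) = ip z x + ip z y.
Proof. by move=> Hx Hy Hz; rewrite !(ipC z) ipDl. Qed.

Lemma ipZr c x y : H x -> H y -> ip y (c *: x) = c * ip y x.
Proof. by move=> Hx Hy; rewrite !(ipC y) ipZl. Qed.

Lemma ipBl x y z : H x -> H y -> H z -> ip (x - y) z = ip x z - ip y z.
Proof.
by move=> Hx Hy Hz; rewrite -scaleN1r ipDl ?ipZl ?mulN1r //; exact: HZ.
Qed.

Lemma ipBr x y z : H x -> H y -> H z -> ip z (x - y) = ip z x - ip z y.
Proof. by move=> Hx Hy Hz; rewrite !(ipC z) ipBl. Qed.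

Lemma ip_normD x y : H x -> H y ->
  ip (x + y) (x + y) = ip x x + 2 * ip x y + ip y y.
Proof.
move=> Hx Hy; have Hxy := HD Hx Hy.
by rewrite ipDl // !ipDr // (ipC y x); ring.
Qed.

Lemma ip_normB x y : H x -> H y ->
  ip (x - y) (x - y) = ip x x - 2 * ip x y + ip y y.
Proof.
move=> Hx Hy; have Hxy := H_sub Hx Hy.
by rewrite ipBl // !ipBr // (ipC y x); ring.
Qed.

Lemma cauchy_schwarz x y : H x -> H y -> ip x y ^+ 2 <= ip x x * ip y y.
Proof.
move=> Hx Hy; apply: discriminant_le => [|t]; first exact: ip_ge0.
have Hty := HZ t Hy; have := ip_ge0 (HD Hx Hty).
by rewrite ip_normD // ipZr // ipZl // ipZr //; lra.
Qed.

(** The triangle inequality for operator bounds a and b, squared so that no square root appears; [c]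
    is the squared norm of the argument. *)
Lemma ip_normD_le x y a b c : H x -> H y -> 0 <= a -> 0 <= b -> 0 <= c ->
  ip x x <= a ^+ 2 * c -> ip y y <= b ^+ 2 * c ->
  ip (x + y) (x + y) <= (a + b) ^+ 2 * c.
Proof.
move=> Hx Hy a_ge0 b_ge0 c_ge0 xa yb; rewrite ip_normD //.
have xy : ip x y <= a * b * c.
  apply: le_trans (ler_norm _) _.
  rewrite -(ler_pXn2r (ltn0Sn 1)) ?nnegrE ?mulr_ge0 // real_normK ?num_real //.
  apply: le_trans (cauchy_schwarz Hx Hy) _.
  have -> : (a * b * c) ^+ 2 = (a ^+ 2 * c) * (b ^+ 2 * c) by ring.
  by rewrite ler_pM // ip_ge0.
have -> : (a + b) ^+ 2 * c = a ^+ 2 * c + 2 * (a * b * c) + b ^+ 2 * c by ring.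
by lra.
Qed.

Section SymmetricContraction.
Variable S : V -> V.
(** The last hypothesis reads S^2 <= S, that is 0 <= S <= 1 for a symmetric S. *)
Hypotheses (HS : forall x, H x -> H (S x))
  (S_sym : forall x y, H x -> H y -> ip (S x) y = ip x (S y))
  (S_contr : forall x, H x -> ip (S x) (S x) <= ip (S x) x).

Lemma H_iter m x : H x -> H (iter m S x).
Proof. by move=> Hx; elim: m => //= m; exact: HS. Qed.

Lemma ip_iter m n x y : H x -> H y ->
  ip (iter m S x) (iter n S y) = ip (iter (m + n) S x) y.
Proof.
move=> Hx Hy; elim: n m => [|n IHn] m; first by rewrite addn0.
by rewrite iterS -S_sym -?iterS ?IHn ?addSnnS //; exact: H_iter.
Qed.

Lemma ip_contraction x : H x -> ip (S x) x <= ip x x.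
Proof.
move=> Hx; have Hs := HS Hx; have := ip_ge0 (H_sub Hx Hs).
by rewrite ip_normB // (ipC x); have := S_contr Hx; lra.
Qed.

(** Symmetry moves half of the powers to the other side: with y = S^s x the product is |y|^2 for m =
    2 s and <S y, y> >= |S y|^2 for m = 2 s + 1. *)
Lemma ip_iter_ge0 m x : H x -> 0 <= ip (iter m S x) x.
Proof.
move=> Hx; rewrite -(odd_double_half m) -addnn; set s := m./2.
have Hs := H_iter s Hx; case: odd; rewrite ?add0n ?add1n.
  rewrite -addSn -ip_iter // iterS.
  by apply: le_trans (S_contr Hs); apply/ip_ge0/HS.
by rewrite -ip_iter // ip_ge0.
Qed.

Lemma ip_iter_nonincreasing m x : H x ->
  ip (iter m.+1 S x) x <= ip (iter m S x) x.
Proof.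
move=> Hx; rewrite -(odd_double_half m) -addnn; set s := m./2.
have Hs := H_iter s Hx; case: odd; rewrite ?add0n ?add1n.
  have -> : (s + s).+2 = (s.+1 + s.+1)%N by lia.
  by rewrite -addSn -!ip_iter // iterS; exact: S_contr.
by rewrite -addSn -!ip_iter // iterS; exact: ip_contraction.
Qed.

(** With c_j = <S^j x, x>, the squared distance is c_(2m) - 2 c_(m+n) + c_(2n), and c_j is
    nonincreasing and nonnegative. *)
Lemma ip_iter_cauchy x eps : H x -> 0 < eps ->
  exists N, forall m n, (N <= m)%N -> (N <= n)%N ->
    ip (iter m S x - iter n S x) (iter m S x - iter n S x) <= eps.
Proof.
move=> Hx eps_gt0; have eps2 : 0 < eps / 2 by rewrite divr_gt0.
have [N NP] := nonincreasing_bounded_cauchy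
  (fun j => ip_iter_nonincreasing j Hx) (fun j => ip_iter_ge0 j Hx) eps2.
exists N => m n le_Nm le_Nn; rewrite ip_normB; try exact: H_iter.
rewrite !ip_iter //.
have h1 := NP (m + m)%N (m + n)%N ltac:(lia) ltac:(lia).
have h2 := NP (n + n)%N (m + n)%N ltac:(lia) ltac:(lia).
lra.
Qed.

End SymmetricContraction.

End PreHilbert.

Lemma cvg_big_sum (R : realType) (I : Type) (r : seq I) (F : nat -> I ->
  R) (l : I -> R) :
  (forall i, F^~ i @ \oo --> l i) ->
  (fun m => \sum_(i <- r) F m i) @ \oo --> \sum_(i <- r) l i.
Proof.
move=> FP; elim: r => [|i r IHr].
  by rewrite big_nil; under eq_fun do rewrite big_nil; exact: cvg_cst.
by rewrite big_cons; under eq_fun do rewrite big_cons; exact: cvgD.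
Qed.

Lemma cauchy_cvg_real (R : realType) (u : nat -> R) :
  (forall eps, 0 < eps -> exists N, forall m n, (N <= m)%N -> (N <= n)%N ->
     `|u m - u n| < eps) ->
  exists l : R, u @ \oo --> l.
Proof.
move=> uP; suff ucvg : cvgn u by exists (limn u).
apply/cauchy_cvgP/cauchy_exP => eps eps_gt0.
have [N NP] := uP eps eps_gt0; exists (u N), N => // m le_Nm.
exact: NP.
Qed.

(** * Real square-summable functions and the operators of sparse matrices *)

Section L2.
Variables (R : realType) (G : groupType) (k : nat).
Local Notation E := ('I_k -> G -> R^o).
Implicit Types x y z : E.

Definition sqsum (f : G -> R) : Prop := rsummable (fun g => f g ^+ 2).

Definition rl2 x : Prop := forall i, sqsum (x i).

Definition rip x y : R := \sum_i rsum (fun g => x i g * y i g).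

Lemma sqsum_mul f g : sqsum f -> sqsum g -> rsummable (fun h => f h * g h).
Proof.
move=> fS gS; apply: rsummable_le (rsummableD fS gS) => h.
rewrite [leRHS]ger0_norm ?addr_ge0 ?sqr_ge0 // normrM.
rewrite -(real_normK (num_real (f h))) -(real_normK (num_real (g h))).
set a := `|f h|; set b := `|g h|.
have := sqr_ge0 (a - b); have : 0 <= a * b by apply: mulr_ge0; exact: normr_ge0.
by nra.
Qed.

Lemma rl2_add x y : rl2 x -> rl2 y -> rl2 (x + y).
Proof.
move=> xS yS i; have S1 := rsummableZ 2 (rsummableD (xS i) (yS i)).
apply: rsummable_le S1 => g; rewrite !ger0_norm ?sqr_ge0 //; last first.
  by rewrite mulr_ge0 // addr_ge0 ?sqr_ge0.
change ((x i g + y i g) ^+ 2 <= 2 * (x i g ^+ 2 + y i g ^+ 2)).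
by have := sqr_ge0 (x i g - y i g); nra.
Qed.

Lemma rl2_scale c x : rl2 x -> rl2 (c *: x).
Proof.
move=> xS i; apply: rsummable_le (rsummableZ (c ^+ 2) (xS i)) => g.
by rewrite -exprMn.
Qed.

Lemma ripC x y : rip x y = rip y x.
Proof. by apply: eq_bigr => i _; apply: eq_rsum => g; rewrite mulrC. Qed.

Lemma ripDl x y z : rl2 x -> rl2 y -> rl2 z ->
  rip (x + y) z = rip x z + rip y z.
Proof.
move=> xS yS zS; rewrite /rip -big_split; apply: eq_bigr => i _ /=.
rewrite -rsumD; try exact: sqsum_mul.
by apply: eq_rsum => g; rewrite -mulrDl.
Qed.

Lemma ripZl c x y : rl2 x -> rl2 y -> rip (c *: x) y = c * rip x y.
Proof.
move=> xS yS; rewrite /rip mulr_sumr; apply: eq_bigr => i _ /=.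
rewrite -rsumZ; last exact: sqsum_mul.
by apply: eq_rsum => g; rewrite mulrA.
Qed.

Lemma rip_ge0 x : rl2 x -> 0 <= rip x x.
Proof.
move=> xS; apply: sumr_ge0 => i _; apply: rsum_ge0 => g.
by rewrite -expr2 sqr_ge0.
Qed.

Lemma rip0l y : rip 0 y = 0.
Proof.
by rewrite /rip big1 // => i _; rewrite (rsum_at (x := 1%g)) => [|g _];
  exact: mul0r.
Qed.

Lemma rip_sq_ge x i g : rl2 x -> x i g ^+ 2 <= rip x x.
Proof.
move=> xS; rewrite /rip (bigD1 i) //= -[leLHS]addr0 lerD //; last first.
  apply: sumr_ge0 => j _; apply: rsum_ge0 => h.
  by rewrite -expr2 sqr_ge0.
rewrite (eq_rsum (g := fun g => x i g ^+ 2)) //.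
by apply: (le_rsum (f := fun g => x i g ^+ 2)) => [|h];
  [exact: xS | exact: sqr_ge0].
Qed.

Lemma rsum_sum (I : Type) (r : seq I) (F : I -> G -> R) :
  (forall i, rsummable (F i)) ->
  rsum (fun g => \sum_(i <- r) F i g) = \sum_(i <- r) rsum (F i) /\
  rsummable (fun g => \sum_(i <- r) F i g).
Proof.
move=> FS; elim: r => [|i r [IHr IHs]].
  rewrite big_nil; under eq_fun do rewrite big_nil; split.
    by rewrite (rsum_at (x := 1%g)).
  by exists 0 => s _; rewrite big1 // => x _; rewrite normr0.
rewrite big_cons; under eq_fun do rewrite big_cons.
by split; [rewrite rsumD ?IHr | exact: rsummableD].
Qed.

(** Fatou's lemma: the bound holds for every finite partial sum, and these pass to a pointwise
    limit. It plays the part of completeness of l^2. *)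
Lemma rip_lower_semicontinuous (xs : nat -> E) x B :
  (forall m, rl2 (xs m)) -> (\forall m \near \oo, rip (xs m) (xs m) <= B) ->
  (forall i g, (fun m => xs m i g : R) @ \oo --> (x i g : R)) ->
  rl2 x /\ rip x x <= B.
Proof.
move=> xsS xsB xsx.
pose sq (y : E) g : R := \sum_i y i g ^+ 2.
have ipE y : rl2 y -> rip y y = rsum (sq y) /\ rsummable (sq y).
  move=> yS; have [e s] := rsum_sum (index_enum 'I_k) yS.
  split; last exact: s.
  by rewrite /rip -[rsum _]/(rsum (fun g => \sum_i y i g ^+ 2)) e.
have sq_ge0 y g : 0 <= sq y g by apply: sumr_ge0 => i _; rewrite sqr_ge0.
have finB (s : seq G) : uniq s -> \sum_(g <- s) sq x g <= B.
  move=> s_uniq.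
  have cvg_s : (fun m => \sum_(g <- s) sq (xs m) g) @ \oo --> \sum_(g <- s)
    sq x g.
    apply: cvg_big_sum => g; apply: cvg_big_sum => i.
    by under eq_fun do rewrite expr2; rewrite expr2; apply: cvgM; exact: xsx.
  apply: (cvgr_to_le cvg_s); apply: filterS xsB => m; apply: le_trans.
  have [-> sS] := ipE _ (xsS m).
  exact: (rsum_leP (rsum (sq (xs m))) sS (sq_ge0 _)).1.
have sqS : rsummable (sq x).
  exists B => s s_uniq; rewrite (eq_bigr (sq x)) ?finB // => g _.
  by rewrite ger0_norm.
have xS : rl2 x.
  move=> i; apply: rsummable_le sqS => g.
  rewrite !ger0_norm ?sqr_ge0 // /sq (bigD1 i) //= lerDl.
  by apply: sumr_ge0 => j _; rewrite sqr_ge0.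
by split=> //; have [-> _] := ipE x xS; apply/rsum_leP.
Qed.

Section SparseOperator.
Variables (n : nat) (gens : 'I_n -> G).
Local Notation smx := (smatrix 'I_k (letter n)).
Local Notation wv := (weval gens).
Implicit Types (A B : smx) (t : ('I_k * 'I_k) * (int * word n)).

Definition term_op t x : E := fun i h =>
  (t.1.1 == i)%:R * (t.2.1%:~R * x t.1.2 ((wv t.2.2)^-1 * h)%g).

Definition sop A x : E := \sum_(t <- A) term_op t x.

Lemma sopE A x i h : sop A x i h = \sum_(t <- A)
  (t.1.1 == i)%:R * (t.2.1%:~R * x t.1.2 ((wv t.2.2)^-1 * h)%g).
Proof. by rewrite /sop !fct_sumE. Qed.

Lemma term_op_rl2 t x : rl2 x -> rl2 (term_op t x).
Proof.
move=> xS i; rewrite /sqsum /term_op.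
have S1 := rsummableZ (((t.1.1 == i)%:R * t.2.1%:~R) ^+ 2)
  (rsummable_translate (wv t.2.2)^-1 (xS t.1.2)).
by apply: rsummable_le S1 => g; rewrite mulrA exprMn.
Qed.

Lemma rl2_0 : rl2 0.
Proof.
by move=> i; exists 0 => s _; rewrite big1 // => g _; rewrite expr0n normr0.
Qed.

Lemma sop_rl2 A x : rl2 x -> rl2 (sop A x).
Proof.
move=> xS; rewrite /sop; elim: A => [|t A IHA]; first by rewrite big_nil;
  exact: rl2_0.
by rewrite big_cons; apply: rl2_add => //; exact: term_op_rl2.
Qed.

Lemma rip_term_op t x y : rip (term_op t x) y =
  rsum (fun g => t.2.1%:~R * x t.1.2 ((wv t.2.2)^-1 * g)%g * y t.1.1 g).
Proof.
rewrite /rip (bigD1 t.1.1) //= big1 ?addr0 => [|i neq].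
  by apply: eq_rsum => g; rewrite /term_op eqxx mul1r.
rewrite (rsum_at (x := 1%g)) => [|g _];
  rewrite /term_op eq_sym (negPf neq) !mul0r //.
Qed.

Definition star_term t := ((t.1.2, t.1.1), (t.2.1, winv (@linv n) t.2.2)).

Lemma rip_term_op_star t x y :
  rip (term_op t x) y = rip x (term_op (star_term t) y).
Proof.
rewrite [RHS]ripC !rip_term_op /= weval_winv invgK.
rewrite -(rsum_translate _ (wv t.2.2)); apply: eq_rsum => g.
by rewrite mulKg mulrAC.
Qed.

Lemma rip_sop_sstar A x y : rl2 x -> rl2 y ->
  rip (sop A x) y = rip x (sop (sstar (@linv n) A) y).
Proof.
move=> xS yS; rewrite /sop big_map; elim: A => [|t A IHA].
  by rewrite !big_nil (ripC x) !rip0l.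
have yA : rl2 (\sum_(u <- A) term_op (star_term u) y).
  by have := sop_rl2 (sstar (@linv n) A) yS; rewrite /sop big_map.
rewrite !big_cons (ripDl (term_op_rl2 t xS) (sop_rl2 A xS) yS) IHA.
rewrite [RHS]ripC (ripDl (term_op_rl2 (star_term t) yS) yA xS).
by rewrite rip_term_op_star (ripC x) (ripC x).
Qed.

(** A single term moves one coordinate by a translation and scales it by its coefficient, so its
    norm is at most the absolute coefficient; the triangle inequality adds these up. *)
Lemma sop_norm_le A x : rl2 x ->
  rip (sop A x) (sop A x) <= (snorm A)%:R ^+ 2 * rip x x.
Proof.
move=> xS; rewrite /sop /snorm; elim: A => [|t A IHA].
  by rewrite !big_nil rip0l expr0n mul0r.
rewrite !big_cons natrD; apply: (ip_normD_le rl2_add rl2_scale ripC ripDl ripZl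
  rip_ge0) => //.
- exact: term_op_rl2.
- exact: (sop_rl2 A).
- exact: rip_ge0.
have zE : (`|t.2.1|%N)%:R ^+ 2 = t.2.1%:~R ^+ 2 :> R.
  by rewrite natr_absz intr_norm real_normK ?num_real.
rewrite zE rip_term_op.
rewrite (eq_rsum (g := fun g =>
  t.2.1%:~R ^+ 2 * x t.1.2 ((wv t.2.2)^-1 * g)%g ^+ 2)).
  rewrite rsumZ; last exact: (rsummable_translate _ (xS _)).
  rewrite (rsum_translate (fun g => x t.1.2 g ^+ 2)) ler_wpM2l ?sqr_ge0 //.
  rewrite /rip (bigD1 t.1.2) //= -[leLHS]addr0 lerD //.
  by apply: sumr_ge0 => j _; apply: rsum_ge0 => h; rewrite -expr2 sqr_ge0.
by move=> g; rewrite /term_op eqxx mul1r -expr2 exprMn.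
Qed.

Lemma sop_cat A B x : sop (A ++ B) x = sop A x + sop B x.
Proof. by rewrite /sop big_cat. Qed.

Lemma sop_sscale (z : int) A x : sop (sscale z A) x = z%:~R *: sop A x.
Proof.
apply/funext => i; apply/funext => h.
rewrite -[RHS]/(z%:~R * sop A x i h) !sopE big_map mulr_sumr.
by apply: eq_bigr => t _ /=; rewrite intrM; ring.
Qed.

Lemma sop_sone x : sop (sone _ (enum 'I_k)) x = x.
Proof.
apply/funext => i; apply/funext => h.
rewrite sopE big_map big_enum /= (bigD1 i) //= big1 ?addr0 => [|j /negPf ->].
  by rewrite eqxx !mul1r invg1 mul1g.
by rewrite mul0r.
Qed.

Lemma sop_smul A B x : sop (smul A B) x = sop A (sop B x).
Proof.
apply/funext => i; apply/funext => h; rewrite !sopE big_flatten big_map.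
apply: eq_bigr => a _; rewrite big_map big_filter sopE big_mkcond mulrA
  mulr_sumr.
apply: eq_bigr => b _ /=; rewrite eq_sym; case: eqVneq => _ /=;
  last by rewrite mul0r mulr0.
rewrite weval_cat intrM invgM mulgA mul1r.
by ring.
Qed.

Lemma sop_spow A m x : sop (spow (enum 'I_k) A m) x = iter m (sop A) x.
Proof. by elim: m => [|m IHm]; [exact: sop_sone | rewrite sop_smul IHm]. Qed.

End SparseOperator.

End L2.

(** * The limit of the powers of 1 - A^* A / C, its trace, and the moments *)

Section KernelProjection.
Variables (R : realType) (G : groupType) (k n : nat) (gens : 'I_n -> G).
Variable A : smatrix 'I_k (letter n).
Local Notation E := ('I_k -> G -> R^o).
Implicit Types x y z : E.
Local Notation sop := (sop (R := R) gens).

Let C : R := (sbound A)%:R.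
Let Astar := sstar (@linv n) A.

(** Built from the same [sdefect] as the test, so that the powers of C S are those whose integer
    traces the algorithm computes. *)
Definition shrink x : E :=
  C^-1 *: sop (sdefect (@linv n) (sbound A) (enum 'I_k) A) x.
Local Notation S := shrink.

Let C_gt0 : 0 < C. Proof. by rewrite ltr0n /sbound addn2. Qed.

Let shrinkE x : S x = x - C^-1 *: sop Astar (sop A x).
Proof.
rewrite /S /sdefect sop_cat !sop_sscale sop_sone sop_smul scalerDr !scalerA.
by rewrite mulrN1z mulrN1 scaleNr -pmulrn mulVf ?lt0r_neq0 // scale1r.
Qed.

Let snorm_star : snorm Astar = snorm A.
Proof. by rewrite /snorm big_map. Qed.

Let adj x y : rl2 x -> rl2 y -> rip (sop A x) y = rip x (sop Astar y).
Proof. exact: rip_sop_sstar. Qed.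

Let ipBl := ipBl (@rl2_scale R G k) (@ripDl R G k) (@ripZl R G k).
Let ipBr := ipBr (@rl2_scale R G k) (@ripC R G k) (@ripDl R G k) (@ripZl R G k).
Let ipZr := ipZr (@ripC R G k) (@ripZl R G k).
Let rl2_sub := H_sub (@rl2_add R G k) (@rl2_scale R G k).

Lemma shrink_rl2 x : rl2 x -> rl2 (S x).
Proof. by move=> xS; apply/rl2_scale/sop_rl2. Qed.

Lemma shrink_sym x y : rl2 x -> rl2 y -> rip (S x) y = rip x (S y).
Proof.
move=> xS yS; have [Ax Ay] := (sop_rl2 gens A xS, sop_rl2 gens A yS).
have [AAx AAy] := (sop_rl2 gens Astar Ax, sop_rl2 gens Astar Ay).
rewrite !shrinkE ipBl ?ipBr //; try exact: rl2_scale.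
rewrite ripZl // ipZr // -adj // (ripC (sop _ _)) -adj //.
by rewrite (ripC (sop A y)).
Qed.

(** C (<S x, x> - <S x, S x>) = |A x|^2 - |A^* A x|^2 / C, which is nonnegative because C bounds the
    squared norm of A^*. *)
Lemma shrink_contraction x : rl2 x -> rip (S x) (S x) <= rip (S x) x.
Proof.
move=> xS; have Ax := sop_rl2 gens A xS; have AAx := sop_rl2 gens Astar Ax.
have cAAx := rl2_scale C^-1 AAx; have Sx := shrink_rl2 xS.
rewrite {2}shrinkE ipBr // lerBlDr lerDl ipZr // mulr_ge0 ?invr_ge0 ?(ltW
  C_gt0) //.
rewrite shrinkE ipBl // ripZl // -adj // subr_ge0 mulrC ler_pdivrMr //.
apply: (le_trans (sop_norm_le gens Astar Ax)).
rewrite mulrC ler_wpM2l ?rip_ge0 // snorm_star -natrX ler_nat.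
by rewrite /sbound leq_addr.
Qed.

Let iter_rl2 m x := @H_iter _ _ _ _ shrink_rl2 m x.
Let iter_cauchy := ip_iter_cauchy (@rl2_add R G k) (@rl2_scale R G k)
  (@ripC R G k) (@ripDl R G k) (@ripZl R G k) (@rip_ge0 R G k)
  shrink_rl2 shrink_sym shrink_contraction.
Let iter_nonincreasing :=
  ip_iter_nonincreasing (@rl2_add R G k) (@rl2_scale R G k)
  (@ripC R G k) (@ripDl R G k) (@ripZl R G k) (@rip_ge0 R G k)
  shrink_rl2 shrink_sym shrink_contraction.

(** Defining the projection as the limit of the powers of S gives the convergence of the moments at
    the same time. *)
Definition kproj x : E := fun i g => limn (fun m => iter m S x i g : R).

Lemma kproj_cvg x i g : rl2 x ->
  (fun m => iter m S x i g : R) @ \oo --> (kproj x i g : R).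
Proof.
move=> xS; suff [l ul] : exists l : R, (fun m =>
  iter m S x i g : R) @ \oo --> l.
  by rewrite /kproj (cvg_lim _ ul).
apply: cauchy_cvg_real => eps eps_gt0.
have e2 : 0 < (eps / 2) ^+ 2 by rewrite exprn_gt0 // divr_gt0.
have [N NP] := iter_cauchy xS e2; exists N => m p le_Nm le_Np.
have := NP m p le_Nm le_Np; have Smp := rl2_sub (iter_rl2 m xS) (iter_rl2 p xS).
move=> /(le_trans (rip_sq_ge i g Smp)) le2.
apply: (@le_lt_trans _ _ (eps / 2)); last by lra.
rewrite -(ler_pXn2r (ltn0Sn 1)) ?nnegrE ?normr_ge0 //; last by lra.
by rewrite real_normK ?num_real.
Qed.

(** Semicontinuity applied to S^m x - S^p x, with p tending to infinity, upgrades the pointwise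
    limit to a limit in norm. *)
Lemma kproj_norm_cvg x eps : rl2 x -> 0 < eps ->
  rl2 (kproj x) /\ \forall m \near \oo,
    rip (iter m S x - kproj x) (iter m S x - kproj x) <= eps.
Proof.
move=> xS eps_gt0; have [N NP] := iter_cauchy xS eps_gt0.
have lsc m : (N <= m)%N -> rl2 (iter m S x - kproj x) /\
    rip (iter m S x - kproj x) (iter m S x - kproj x) <= eps.
  move=> le_Nm.
  apply: (@rip_lower_semicontinuous _ _ _ (fun p => iter m S x - iter p S x)).
  - by move=> p; apply: rl2_sub; exact: iter_rl2.
  - by exists N => // p /= le_Np; exact: NP.
  - move=> i g; apply: cvgB; first exact: cvg_cst.
    exact: kproj_cvg.
split; last by exists N => // m /= /lsc[].
have [d _] := lsc N (leqnn N).
have -> : kproj x = iter N S x - (iter N S x - kproj x) by rewrite subKr.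
by apply: rl2_sub => //; exact: iter_rl2.
Qed.

Lemma kproj_rl2 x : rl2 x -> rl2 (kproj x).
Proof. by move=> xS; case: (kproj_norm_cvg xS ltr01). Qed.

Lemma sop_cvg B (xs : nat -> E) x :
  (forall i g, (fun m => xs m i g : R) @ \oo --> (x i g : R)) ->
  forall i g, (fun m => sop B (xs m) i g : R) @ \oo --> (sop B x i g : R).
Proof.
move=> xsx i g; rewrite sopE; under eq_fun do rewrite sopE.
apply: cvg_big_sum => t; apply: cvgMr; apply: cvgMr.
exact: xsx.
Qed.

Lemma rip_eq0 x : rl2 x -> rip x x = 0 -> x = 0.
Proof.
move=> xS x0; apply/funext => i; apply/funext => g.
by have := rip_sq_ge i g xS; rewrite x0 => h; apply/eqP;
  rewrite -sqrf_eq0 eq_le h sqr_ge0.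
Qed.

Lemma shrink_kproj x : rl2 x -> S (kproj x) = kproj x.
Proof.
move=> xS; apply/funext => i; apply/funext => g.
have c1 : (fun m => iter m.+1 S x i g : R) @ \oo --> (kproj x i g : R).
  by have := @kproj_cvg x i g xS;
    rewrite -(cvg_shiftS (fun m => iter m S x i g : R)).
have c2 : (fun m => iter m.+1 S x i g : R) @ \oo --> (S (kproj x) i g : R).
  apply: cvgMr; apply: sop_cvg => j h; exact: kproj_cvg.
exact: (cvg_unique _ c2 c1).
Qed.

(** A fixed vector satisfies A^* A x = 0, and then |A x|^2 = <x, A^* A x> = 0. *)
Lemma shrink_fixed x : rl2 x -> S x = x <-> sop A x = 0.
Proof.
move=> xS; have Ax := sop_rl2 gens A xS; have AAx := sop_rl2 gens Astar Ax.
rewrite shrinkE; split=> [|->]; last first.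
  have -> : sop Astar 0 = 0.
    apply/funext => i; apply/funext => g; rewrite sopE big1 // => t _.
    have z0 j h : (0 : E) j h = 0 by [].
    by rewrite z0 !mulr0.
  by rewrite scaler0 subr0.
move=> /eqP; rewrite -subr_eq0 addrAC subrr add0r oppr_eq0 scaler_eq0.
rewrite invr_eq0 (negPf (lt0r_neq0 C_gt0)) /= => /eqP AA0.
by apply: rip_eq0 => //; rewrite adj // AA0 ripC rip0l.
Qed.

Lemma sop_kproj x : rl2 x -> sop A (kproj x) = 0.
Proof. by move=> xS; apply/shrink_fixed;
  [exact: kproj_rl2 | exact: shrink_kproj]. Qed.

(** S fixes y and is symmetric, so <S^m x, y> = <x, y> for all m; norm convergence and
    Cauchy-Schwarz carry this to the limit. *)
Lemma kproj_orthogonal x y : rl2 x -> rl2 y -> sop A y = 0 ->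
  rip (x - kproj x) y = 0.
Proof.
move=> xS yS Ay0; have Pxl := kproj_rl2 xS.
have Sy m : rip (iter m S x) y = rip x y.
  elim: m => //= m <-; rewrite shrink_sym //; last exact: iter_rl2.
  by rewrite (shrink_fixed yS).2.
have xP m : rip (x - kproj x) y = rip (iter m S x - kproj x) y.
  by rewrite !ipBl ?Sy //; exact: iter_rl2.
apply/eqP; rewrite -sqrf_eq0 eq_le sqr_ge0 andbT.
apply/ler_addgt0Pr => eps eps_gt0; rewrite add0r.
(* The [+ 1] keeps the denominator positive when y = 0. *)
pose eps' := eps / (rip y y + 1).
have yy := rip_ge0 yS.
have eps'_gt0 : 0 < eps' by rewrite divr_gt0 // ltr_wpDl.
have [_ [N _ NP]] := kproj_norm_cvg xS eps'_gt0.
have dS := rl2_sub (iter_rl2 N xS) Pxl.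
rewrite (xP N); apply: (le_trans (cauchy_schwarz (@rl2_add R G k)
  (@rl2_scale R G k)
  (@ripC R G k) (@ripDl R G k) (@ripZl R G k) (@rip_ge0 R G k) dS yS)).
apply: (le_trans (ler_wpM2r yy (NP N (leqnn N)))).
by rewrite /eps' mulrAC ler_pdivrMr ?ltr_wpDl // ler_wpM2l ?lerDl // ltW.
Qed.

Definition zeta (i : 'I_k) : E := fun j g => ((j == i) && (g == 1%g))%:R.

Lemma zeta_rl2 i : rl2 (zeta i).
Proof.
move=> j; exists 1 => s s_uniq.
apply: (@le_trans _ _ (\sum_(g <- s) (g == 1%g)%:R)).
  apply: ler_sum => g _; rewrite /zeta.
  by case: (j == i); case: (g == 1%g);
    rewrite ?expr1n ?expr0n ?normr1 ?normr0 ?ler01.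
rewrite -natr_sum (eq_bigr (fun g => if g == 1%g then 1%N else 0%N));
  last first.
  by move=> g _; case: eqP.
rewrite -big_mkcond sum1_count lern1.
by rewrite (count_uniq_mem _ s_uniq); case: (_ \in _).
Qed.

Lemma rip_zeta x i : rip x (zeta i) = x i 1%g.
Proof.
rewrite /rip (bigD1 i) //= big1 ?addr0 => [|j neq].
  rewrite (rsum_at (x := 1%g)) /zeta ?eqxx ?mulr1 // => g /negPf ->.
  by rewrite andbF mulr0.
by rewrite (rsum_at (x := 1%g)) => [|g _]; rewrite /zeta (negPf neq) mulr0.
Qed.

Definition kdim : R := \sum_i kproj (zeta i) i 1%g.
Definition moment m : R := \sum_i iter m S (zeta i) i 1%g.

Lemma moment_cvg : moment @ \oo --> kdim.
Proof. by apply: cvg_big_sum => i; apply/kproj_cvg/zeta_rl2. Qed.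

Lemma kdim_le_moment m : kdim <= moment m.
Proof.
have dec p : moment (m + p) <= moment m.
  elim: p => [|p IHp]; first by rewrite addn0.
  apply: le_trans IHp; apply: ler_sum => i _; rewrite -!rip_zeta addnS.
  exact: iter_nonincreasing (zeta_rl2 i).
apply: (cvgr_to_le moment_cvg); exists m => // p /= le_mp.
by rewrite -(subnKC le_mp).
Qed.

Lemma moment_le_kdim m delta : (forall p, (m <= p)%N ->
  moment m <= moment p + delta) ->
  moment m <= kdim + delta.
Proof.
move=> le_p; rewrite -lerBlDr; apply: (cvgr_to_ge moment_cvg).
by exists m => // p /= /le_p; rewrite lerBlDr.
Qed.

(** Faithfulness of the trace: its summands are the squared norms |P zeta_i|^2, so d = 0 makes
    kernel vectors orthogonal to every zeta_i, that is, zero at the identity. *)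
Lemma kdim_eq0 : kdim = 0 <-> forall x, rl2 x -> sop A x = 0 -> x = 0.
Proof.
have normE i : kproj (zeta i) i 1%g = rip (kproj (zeta i)) (kproj (zeta i)).
  have zS := zeta_rl2 i; have PS := kproj_rl2 zS.
  have := kproj_orthogonal zS PS (sop_kproj zS); rewrite ipBl // => /eqP.
  by rewrite subr_eq0 => /eqP <-; rewrite ripC rip_zeta.
split=> [d0 x xS Ax0|ker0]; last first.
  rewrite /kdim big1 // => i _; rewrite (ker0 (kproj (zeta i))) //.
    exact/kproj_rl2/zeta_rl2.
  exact/sop_kproj/zeta_rl2.
apply/funext => j; apply/funext => h.
(* Right translations commute with the left action, so [y] is again in the kernel; its value at 1 is
   that of [x] at [h]. *)
pose y : E := fun i g => x i (g * h)%g.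
have yS : rl2 y by move=> i; exact: (rsummable_translater _ (xS i)).
have Ay0 : sop A y = 0.
  apply/funext => i; apply/funext => g.
  transitivity (sop A x i (g * h)%g); last by rewrite Ax0.
  rewrite !sopE; apply: eq_bigr => t _.
  by rewrite /y mulgA.
have Pz0 : kproj (zeta j) = 0.
  apply: rip_eq0; first exact/kproj_rl2/zeta_rl2.
  rewrite -normE; apply: (psumr_eq0P _ d0) => // i _.
  by rewrite normE rip_ge0 //; exact/kproj_rl2/zeta_rl2.
have := kproj_orthogonal (zeta_rl2 j) yS Ay0.
by rewrite Pz0 subr0 ripC rip_zeta /y mul1g => ->.
Qed.

(** C^m S^m is the operator of the m-th formal power, and a term with word w contributes to the
    value at the identity only if w evaluates to 1. *)
Lemma moment_strace m : moment m * C ^+ m =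
  (strace (fun w => weval gens w == 1%g)
    (spow (enum 'I_k) (sdefect (@linv n) (sbound A) (enum 'I_k) A) m))%:~R.
Proof.
set D := sdefect _ _ _ _.
have sopZ c x : sop D (c *: x) = c *: sop D x.
  apply/funext => i; apply/funext => g.
  rewrite -[RHS]/(c * sop D x i g) !sopE mulr_sumr; apply: eq_bigr => t _.
  by rewrite -[(c *: x) _ _]/(c * x _ _); ring.
have iterE x : C ^+ m *: iter m S x = sop (spow (enum 'I_k) D m) x.
  rewrite sop_spow; elim: m => [|p IHp]; first by rewrite scale1r.
  rewrite iterS [in RHS]iterS -IHp sopZ /S scalerA exprS mulrAC divff ?mul1r //.
  exact: lt0r_neq0.
rewrite /moment mulr_suml.
rewrite (eq_bigr (fun i => sop (spow (enum 'I_k) D m) (zeta i) i 1%g));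
  last first.
  by move=> i _; rewrite -iterE mulrC.
rewrite (eq_bigr _ (fun i _ => sopE _ _ _ _ _)) exchange_big /= /strace.
rewrite (rmorph_sum intr) [RHS]big_mkcond /=; apply: eq_bigr => t _.
rewrite (bigD1 t.1.1) //= big1 ?addr0 => [|i neq]; last first.
  by rewrite eq_sym (negPf neq) mul0r.
rewrite eqxx mul1r /zeta mulg1 invg_eq1 eq_sym.
by case: (_ && _); rewrite ?mulr1 ?mulr0.
Qed.

End KernelProjection.

(** * Complex coefficients and von Neumann dimension *)

(** Words with equal values are collected and may cancel, so the support can be smaller than the set
    of values; the elements lost contribute 0. *)
Lemma formal_eval_sum (U : pzRingType) (G : groupType) n (gens : 'I_n -> G)
    (a : formal n) (phi : G -> U) :
  \sum_(g <- finsupp (formal_eval gens a)) (formal_eval gens a g)%:~R * phi g =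
  \sum_(t <- a) t.1%:~R * phi (weval gens t.2).
Proof.
pose K := [fset weval gens t.2 | t in a]%fset.
have evalE g : formal_eval gens a g = \sum_(t <- a | weval gens t.2 == g) t.1.
  rewrite /formal_eval fsfunE; case: ifP => // /negbT.
  rewrite seq_fsetE => notin;
    rewrite big_seq_cond big1 // => t /andP[ta /eqP wt].
  by case/negP: notin; rewrite -wt; apply: (map_f (fun t => weval gens t.2)).
have uK : uniq (undup [seq weval gens t.2 | t <- a]) by exact: undup_uniq.
transitivity (\sum_(g <- undup [seq weval gens t.2 | t <- a])
                (formal_eval gens a g)%:~R * phi g).
  rewrite [RHS](bigID (fun g => g \in finsupp (formal_eval gens a))) /=.
  rewrite [X in _ = _ + X]big1 ?addr0 => [|g]; last first.
    by rewrite memNfinsupp => /eqP ->; rewrite mulr0z mul0r.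
  rewrite -[RHS]big_filter; apply: perm_big; apply: uniq_perm.
  - exact: fset_uniq.
  - exact: filter_uniq.
  move=> g; rewrite mem_filter mem_undup andb_idr // mem_finsupp evalE => ne0.
  apply: contraNT ne0 => notin; apply/eqP; rewrite big_seq_cond big1 //.
  move=> t /andP[ta /eqP wt]; case/negP: notin; rewrite -wt.
  by apply: (map_f (fun t => weval gens t.2)).
rewrite (eq_bigr (fun g =>
  \sum_(t <- a | weval gens t.2 == g) t.1%:~R * phi g)).
  rewrite (exchange_big_dep xpredT) //= big_seq [RHS]big_seq;
    apply: eq_bigr => t ta.
  rewrite -big_filter (eq_filter (a2 := pred1 (weval gens t.2))); last first.
    by move=> g /=; rewrite eq_sym.
  rewrite filter_pred1_uniq // ?big_seq1 // mem_undup.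
  exact: (map_f (fun t => weval gens t.2)).
move=> g _; rewrite evalE (rmorph_sum intr) mulr_suml.
by [].
Qed.

Section ComplexTransfer.
Local Open Scope complex_scope.
Variables (R : realType) (G : groupType) (k n : nat) (gens : 'I_n -> G).
Variable M : 'M[formal n]_k.
Local Notation E := ('I_k -> G -> R^o).
Local Notation EC := ('I_k -> G -> R[i]).
Implicit Types x y : EC.

Let A := entries M.
Let MG := map_mx (formal_eval gens) M.

Definition re x : E := fun i g => complex.Re (x i g).
Definition im x : E := fun i g => complex.Im (x i g).
Definition cplx (u v : E) : EC := fun i g => u i g +i* v i g.

Let ReD (a b : R[i]) : complex.Re (a + b) = complex.Re a + complex.Re b.
Proof. by case: a; case: b. Qed.
Let ImD (a b : R[i]) : complex.Im (a + b) = complex.Im a + complex.Im b.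
Proof. by case: a; case: b. Qed.

Let ReB (a : R[i]) (u v : R) : complex.Re (a - (u +i* v)) = complex.Re a - u.
Proof. by case: a. Qed.
Let ImB (a : R[i]) (u v : R) : complex.Im (a - (u +i* v)) = complex.Im a - v.
Proof. by case: a. Qed.

Let Re_sum (I : Type) (r : seq I) (F : I -> R[i]) :
  complex.Re (\sum_(i <- r) F i) = \sum_(i <- r) complex.Re (F i).
Proof. by apply: (big_morph _ ReD). Qed.
Let Im_sum (I : Type) (r : seq I) (F : I -> R[i]) :
  complex.Im (\sum_(i <- r) F i) = \sum_(i <- r) complex.Im (F i).
Proof. by apply: (big_morph _ ImD). Qed.

Let intE (z : int) : z%:~R = (z%:~R : R)%:C :> R[i].
Proof. by rewrite -[RHS]/(real_complex R z%:~R) rmorph_int. Qed.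

Let Re_int (z : int) (c : R[i]) : complex.Re (z%:~R * c) = z%:~R * complex.Re c.
Proof. by rewrite intE; case: c => a b /=; rewrite mul0r subr0. Qed.
Let Im_int (z : int) (c : R[i]) : complex.Im (z%:~R * c) = z%:~R * complex.Im c.
Proof. by rewrite intE; case: c => a b /=; rewrite mul0r addr0. Qed.

Lemma sop_entries (x : E) i h : sop gens A x i h =
  \sum_j \sum_(t <- M i j) t.1%:~R * x j ((weval gens t.2)^-1 * h)%g.
Proof.
rewrite sopE /A /entries big_flatten big_map big_enum /= (bigD1 i) //=.
rewrite [X in _ + X]big1 ?addr0 => [|i' neq].
  rewrite big_flatten big_map big_enum /=; apply: eq_bigr => j _.
  by rewrite big_map; apply: eq_bigr => t _ /=; rewrite eqxx mul1r.
rewrite big_flatten big_map big_enum /= big1 // => j _;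
  rewrite big_map big1 // => t _ /=.
by rewrite (negPf neq) mul0r.
Qed.

Lemma mxact_sop x i h : mxact MG x i h =
  sop gens A (re x) i h +i* sop gens A (im x) i h.
Proof.
have mxE' : mxact MG x i h =
    \sum_j \sum_(t <- M i j) t.1%:~R * x j ((weval gens t.2)^-1 * h)%g.
  apply: eq_bigr => j _; rewrite /MG mxE.
  exact: (formal_eval_sum gens (M i j) (fun g => x j (g^-1 * h)%g)).
apply/eqP; rewrite eq_complex /= mxE' !sop_entries Re_sum Im_sum.
apply/andP; split; apply/eqP; apply: eq_bigr => j _.
  by rewrite Re_sum; apply: eq_bigr => t _; rewrite Re_int.
by rewrite Im_sum; apply: eq_bigr => t _; rewrite Im_int.
Qed.

Lemma l2P x : l2 x <-> rl2 (re x) /\ rl2 (im x).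
Proof.
have sumE i : (\esum_(g in [set: G])
    (complex.Re (x i g) ^+ 2 + complex.Im (x i g) ^+ 2)%:E < +oo)%E <->
    rsummable (fun g => re x i g ^+ 2 + im x i g ^+ 2).
  rewrite rsummableP.
  rewrite (eq_esum (b := fun g => (`|re x i g ^+ 2 + im x i g ^+ 2|)%:E)) // =>
    g _.
  by rewrite ger0_norm // addr_ge0 ?sqr_ge0.
split=> [xS|[rS iS] i]; last by apply/sumE; exact: (rsummableD (rS i) (iS i)).
split=> i; apply: rsummable_le ((sumE i).1 (xS i)) => g;
  by rewrite !ger0_norm ?addr_ge0 ?sqr_ge0 // ?lerDl ?lerDr sqr_ge0.
Qed.

Lemma in_kerP x : in_ker MG x <->
  (rl2 (re x) /\ rl2 (im x)) /\ (sop gens A (re x) = 0 /\ sop gens A (im x)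
    = 0).
Proof.
rewrite /in_ker l2P; split=> -[xS xK]; split=> //.
  by split; apply/funext => i; apply/funext => h; have := xK i h;
    rewrite mxact_sop => -[].
by move=> i h; rewrite mxact_sop; case: xK => -> ->.
Qed.

Lemma inner_rip x y : l2 x -> l2 y ->
  inner x y = (rip (re x) (re y) + rip (im x) (im y)) +i*
              (rip (im x) (re y) - rip (re x) (im y)).
Proof.
move=> /l2P[xr xi] /l2P[yr yi]; rewrite /inner /csum.
have -> : \sum_i (rsum (fun g => complex.Re (x i g * (y i g)^*)) +i*
                  rsum (fun g => complex.Im (x i g * (y i g)^*))) =
    (\sum_i (rsum (fun g => complex.Re (x i g * (y i g)^*)))) +i*
    (\sum_i (rsum (fun g => complex.Im (x i g * (y i g)^*)))) :> R[i].
  by apply/eqP; rewrite eq_complex /= Re_sum Im_sum !eqxx.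
congr (_ +i* _).
  rewrite -big_split; apply: eq_bigr => i _ /=.
  rewrite -rsumD; try exact: sqsum_mul.
  apply: eq_rsum => g; rewrite /re /im; case: (x i g) => a b;
    case: (y i g) => c d /=.
  by rewrite mulrN opprK.
rewrite -sumrN -big_split; apply: eq_bigr => i _ /=.
rewrite -rsumN -rsumD; try exact: sqsum_mul; last first.
  apply: rsummable_le (sqsum_mul (xr i) (yi i)) => g; by rewrite normrN.
apply: eq_rsum => g; rewrite /re /im; case: (x i g) => a b;
  case: (y i g) => c d /=.
by rewrite mulrN addrC.
Qed.

Local Notation P := (kproj gens A).
Local Notation d := (kdim R gens A).

(** Integer coefficients act separately on real and imaginary parts. The complex kernel is thus the
    complexification of the real one, and applying [P] to both parts is its orthogonal
    projection. *)
Lemma kdim_dim_vN_ker : dim_vN_ker MG d.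
Proof.
have re0 (i : 'I_k) : im (@zeta_e R G k i) = 0.
  by apply/funext => j; apply/funext => g; rewrite /im /zeta_e; case: (_ && _).
have rez (i : 'I_k) : re (@zeta_e R G k i) = zeta R i.
  by apply/funext => j; apply/funext => g; rewrite /re /zeta_e /zeta;
    case: (_ && _).
have zl2 (i : 'I_k) : l2 (@zeta_e R G k i).
  by apply/l2P; rewrite re0 rez; split; [exact: zeta_rl2 | exact: rl2_0].
have kerP x : l2 x -> in_ker MG (cplx (P (re x)) (P (im x))).
  move=> /l2P[xr xi]; apply/in_kerP; split; split.
  - exact: kproj_rl2.
  - exact: kproj_rl2.
  - exact: (sop_kproj gens A xr).
  - exact: (sop_kproj gens A xi).
exists (fun x => cplx (P (re x)) (P (im x))); split.
  move=> x xS; split; first exact: kerP.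
  move=> y yK; have [[yr yi] [Kr Ki]] := (in_kerP y).1 yK.
  have [xr xi] := (l2P x).1 xS.
  have [pr pi] := (kproj_rl2 gens A xr, kproj_rl2 gens A xi).
  pose z : EC := fun i h => x i h - cplx (P (re x)) (P (im x)) i h.
  have rez' : re z = re x - P (re x).
    by apply/funext => i; apply/funext => g; exact: ReB.
  have imz' : im z = im x - P (im x).
    by apply/funext => i; apply/funext => g; exact: ImB.
  have rl2_sub := H_sub (@rl2_add R G k) (@rl2_scale R G k).
  have zS : l2 z by apply/l2P; rewrite rez' imz'; split; exact: rl2_sub.
  rewrite -[LHS]/(inner z y) inner_rip //; last by case: yK.
  by rewrite rez' imz' !(kproj_orthogonal (y :=
    re y)) // !(kproj_orthogonal (y := im y)) // subr0 addr0.
rewrite /kdim.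
have -> : (\sum_i kproj gens A (zeta R i) i 1%g)%:C =
          \sum_i (kproj gens A (zeta R i) i 1%g)%:C.
  exact: (rmorph_sum (real_complex R)).
apply: eq_bigr => i _; rewrite inner_rip //; last by case: (kerP _ (zl2 i)).
(* The imaginary part of zeta_i is 0. Orthogonality of 0 - P 0 to the kernel vector P 0 gives |P
   0|^2 = 0. *)
have P0 : P (0 : E) = (0 : E).
  have z0 := @rl2_0 R G k; apply: rip_eq0; first exact: kproj_rl2.
  have := kproj_orthogonal z0 (kproj_rl2 gens A z0) (sop_kproj gens A z0).
  rewrite (ipBl (@rl2_scale R G k) (@ripDl R G k) (@ripZl R G k)) //;
    try exact: kproj_rl2.
  by rewrite rip0l sub0r => /eqP; rewrite oppr_eq0 => /eqP.
rewrite -[re (cplx _ _)]/(P (re (@zeta_e R G k i)))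
  -[im (cplx _ _)]/(P (im (@zeta_e R G k i))).
rewrite re0 rez P0 rip_zeta !(ripC _ 0) !rip0l.
by rewrite addr0 subr0.
Qed.

Lemma ker_trivialP : ker_trivial R MG <-> d = 0.
Proof.
rewrite kdim_eq0; split=> [ker0 x xS Ax0|ker0 x /in_kerP[[xr xi] [Kr Ki]] i g].
  have xK : in_ker MG (cplx x 0).
    have sop0 : sop gens A (0 : E) = 0.
      apply/funext => i; apply/funext => g; rewrite sopE big1 // => t _.
      have z0 j h : (0 : E) j h = 0 by [].
      by rewrite z0 !mulr0.
    by apply/in_kerP; split; split=> //; exact: rl2_0.
  apply/funext => i; apply/funext => g.
  by have [] := ker0 _ xK i g.
have := congr1 (fun z : E => z i g) (ker0 _ xr Kr).
have := congr1 (fun z : E => z i g) (ker0 _ xi Ki).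
rewrite /re /im; case: (x i g) => a b /= -> ->.
by [].
Qed.

End ComplexTransfer.

(** * Effective convergence of the moments *)

Lemma sum_enum_val (S : nmodType) (T : finType) (F : T -> S) :
  \sum_z F z = \sum_(i < #|T|) F (enum_val i).
Proof.
rewrite (reindex_omap enum_val (fun z => Some (enum_rank z))) => [|z _].
  by apply: eq_bigl => i; rewrite enum_valK eqxx.
by rewrite /= enum_rankK.
Qed.

(** * Integer matrices from a finite partial action *)

Section FiniteModel.
Variables (k n : nat) (V : finType) (step : V -> letter n -> option V).
Hypothesis stepV : invertible_step step.
Local Notation smx := (smatrix 'I_k (letter n)).
Local Notation T := ('I_k * V)%type.
Implicit Types (A B : smx) (x y : T).

(** Words are followed from the row vertex to the column vertex, which makes concatenation the
    matrix product in the same order; a word that cannot be followed counts as 0. *)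
Definition eval_entry A x y : int := \sum_(t <- A) t.2.1 *
  ([&& t.1.1 == x.1, t.1.2 == y.1 & follow step x.2 t.2.2 == Some y.2])%:R.

Definition eval_mx A : 'M[int]_#|{: T}| :=
  \matrix_(i, j) eval_entry A (enum_val i) (enum_val j).

Lemma eval_mx_cat A B : eval_mx (A ++ B) = eval_mx A + eval_mx B.
Proof. by apply/matrixP => i j; rewrite !mxE /eval_entry big_cat. Qed.

Lemma eval_mx_sscale z A : eval_mx (sscale z A) = z *: eval_mx A.
Proof.
apply/matrixP => i j; rewrite !mxE /eval_entry big_map mulr_sumr.
by apply: eq_bigr => t _; rewrite /= mulrA.
Qed.

Lemma eval_mx_sone : eval_mx (sone _ (enum 'I_k)) = 1%:M.
Proof.
apply/matrixP => i j; rewrite !mxE /eval_entry big_map big_enum /=.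
rewrite -(inj_eq enum_val_inj);
  move: (enum_val i) (enum_val j) => [a v] [b w] /=.
rewrite (bigD1 a) //= big1 ?addr0 => [|c /negPf ->]; last by rewrite mulr0.
by rewrite eqxx mul1r /= (inj_eq Some_inj) xpair_eqE.
Qed.

Lemma eval_mx_sstar A : eval_mx (sstar (@linv n) A) = (eval_mx A)^T.
Proof.
apply/matrixP => i j; rewrite !mxE /eval_entry big_map.
apply: eq_bigr => t _ /=; rewrite -(follow_winv _ _ _ stepV).
by rewrite andbCA.
Qed.

Lemma eval_mx_smul A B : eval_mx (smul A B) = eval_mx A *m eval_mx B.
Proof.
apply/matrixP => i j; rewrite !mxE.
under eq_bigr do rewrite !mxE.
move: (enum_val i) (enum_val j) => x y.
transitivity (\sum_(z : T) eval_entry A x z * eval_entry B z y); last first.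
  by rewrite sum_enum_val.
rewrite /eval_entry big_flatten big_map /=.
under [RHS]eq_bigr do rewrite mulr_suml.
rewrite exchange_big /=; apply: eq_bigr => a _.
under [RHS]eq_bigr do rewrite mulr_sumr.
rewrite exchange_big /= big_map big_filter big_mkcond; apply: eq_bigr => b _ /=.
rewrite follow_cat; case: (follow step x.2 a.2.2) => [v|] /=; last first.
  rewrite big1 => [|z _]; last by rewrite !andbF mulr0 mul0r.
  by case: ifP => _ //; rewrite !andbF mulr0.
rewrite (bigD1 (a.1.2, v)) //= big1 ?addr0 => [|[c u] /=]; last first.
  rewrite xpair_eqE negb_and => neq.
  case: (eqVneq a.1.2 c) neq => [_|_]; last by rewrite andbF mulr0 mul0r.
  rewrite /= (inj_eq Some_inj) eq_sym => /negPf ->.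
  by rewrite andbF mulr0 mul0r.
rewrite !eqxx !andbT (eq_sym b.1.1); case: eqVneq => /= _;
  last by rewrite !mulr0.
case: (a.1.1 == x.1) => /=; last by rewrite !mulr0 mul0r.
by rewrite mulr1 mulrA.
Qed.

Lemma eval_mx_sdefect C A : eval_mx (sdefect (@linv n) C (enum 'I_k) A) =
  C%:Z%:M - (eval_mx A)^T *m eval_mx A.
Proof.
rewrite /sdefect eval_mx_cat !eval_mx_sscale eval_mx_sone eval_mx_smul.
by rewrite eval_mx_sstar scalemx1 scaleN1r.
Qed.

Lemma eval_mx_spow A m :
  eval_mx (spow (enum 'I_k) A m) = iter m (mulmx (eval_mx A)) 1%:M.
Proof.
by elim: m => [|m IHm]; [exact: eval_mx_sone | rewrite eval_mx_smul IHm].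
Qed.

Lemma eval_mx_trace A :
  \tr (eval_mx A) = \sum_v strace (fun w => follow step v w == Some v) A.
Proof.
rewrite /mxtrace; under eq_bigr do rewrite mxE.
transitivity (\sum_(z : T) eval_entry A z z).
  exact: (esym (sum_enum_val _)).
rewrite (eq_bigr (fun z => eval_entry A (z.1, z.2) (z.1, z.2))); last by case.
rewrite -(pair_bigA _ (fun i v => eval_entry A (i, v) (i, v))) exchange_big /=.
apply: eq_bigr => v _; rewrite /eval_entry exchange_big /= /strace
  [RHS]big_mkcond.
apply: eq_bigr => t _ /=; rewrite (bigD1 t.1.1) //= big1 ?addr0 => [|i neq].
  by rewrite eqxx eq_sym /=; case: (_ && _); rewrite ?mulr1 ?mulr0.
by rewrite eq_sym (negPf neq) mulr0.
Qed.

(** From a given vertex a word leads to at most one vertex, so each term meets a row in at most one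
    entry. *)
Lemma eval_entry_norm A x : (\sum_y `|eval_entry A x y|%N <= snorm A)%N.
Proof.
elim: A => [|t A IHA].
  by rewrite big1 // => y _; rewrite /eval_entry big_nil.
have le y : (`|eval_entry (t :: A) x y| <=
             `|eval_entry [:: t] x y| + `|eval_entry A x y|)%N.
  rewrite /eval_entry big_cons big_seq1.
  by move: (t.2.1 * _) (\sum_(j <- A) _) => u v; lia.
apply: (@leq_trans (\sum_y (`|eval_entry [:: t] x y| + `|eval_entry A x y|))%N).
  by apply: leq_sum => y _; exact: le.
rewrite big_split /= /snorm big_cons leq_add //.
under eq_bigr do rewrite /eval_entry big_seq1.
case E: (follow step x.2 t.2.2) => [v|]; last first.
  by rewrite big1 // => y _; rewrite !andbF mulr0.
rewrite (bigD1 (t.1.2, v)) //= big1 ?addn0 => [|[c u] neq].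
  by rewrite abszM; case: (_ && _); rewrite ?muln1 ?muln0.
have -> : (t.1.2 == c) && (Some v == Some u) = false.
  by rewrite (inj_eq Some_inj) -xpair_eqE eq_sym; exact: negPf.
by rewrite andbF mulr0.
Qed.

End FiniteModel.

Lemma snorm_smul (I : eqType) X (A B : smatrix I X) :
  (snorm (smul A B) <= snorm A * snorm B)%N.
Proof.
rewrite /snorm big_flatten big_map /= big_distrl /=; apply: leq_sum => a _.
rewrite big_map big_filter big_distrr /= big_mkcond; apply: leq_sum => b _ /=.
by case: ifP => _ //; rewrite abszM.
Qed.

Lemma strace_norm (I : eqType) X (P : pred (seq X)) (L : smatrix I X) :
  (`|strace P L| <= snorm L)%N.
Proof.
rewrite /strace /snorm; elim: L => [|t L]; first by rewrite !big_nil.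
rewrite !big_cons; move: (\sum_(a <- L | _) _) (\sum_(a <- L) _)%N => s u.
by case: ifP => _; lia.
Qed.

Section Gap.
Variables (R : realType) (G : groupType) (k n : nat) (gens : 'I_n -> G).
Hypothesis G_sofic : sofic R G.
Variable A : smatrix 'I_k (letter n).

Let C := sbound A.
Let D := sdefect (@linv n) C (enum 'I_k) A.
Let L m := spow (enum 'I_k) D m.
Let tau m : int := strace (fun w => weval gens w == 1%g) (L m).

(** At a good vertex the words of L r are loops exactly when they evaluate to 1, so its share of the
    trace is [tau r]. Each of the few bad vertices costs at most twice [snorm (L r)]. *)
Lemma trace_approximation m p (eps : R) : 0 < eps ->
  exists (V : finType) (step : V -> letter n -> option V),
    [/\ (0 < #|V|)%N, invertible_step step &
      forall r, r = m \/ r = p ->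
      `|(\tr (eval_mx step (L r)))%:~R - #|V|%:R * (tau r)%:~R| <=
      eps * #|V|%:R * (2 * (snorm (L r))%:R)].
Proof.
move=> eps_gt0.
(* Good vertices must handle the words of both powers, so that one graph serves [m] and [p]. *)
pose len := (\max_(t <- L m ++ L p) size t.2.2)%N.
have [V [step [V_gt0 stepV goodV]]] := sofic_action gens len G_sofic eps_gt0.
exists V, step; split=> // r rmp; rewrite eval_mx_trace //.
pose bad := [pred v : V | ~~ `[< forall w : word n,
   (size w <= len)%N -> follow step v w = Some v <-> weval gens w = 1%g >]].
have badV : #|bad|%:R <= eps * #|V|%:R.
  move: goodV; set good := [pred v : V | _].
  have -> : #|V| = (#|good| + #|bad|)%N by rewrite -(cardC good); congr addn;
    apply: eq_card.
  by rewrite natrD; lra.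
rewrite (rmorph_sum intr) mulr_natl -sumr_const -sumrB.
apply: (@le_trans _ _ (\sum_(v in bad) (2 * (snorm (L r))%:R))); last first.
  by rewrite sumr_const -[leLHS]mulr_natl ler_wpM2r // mulr_ge0.
rewrite [leRHS]big_mkcond /= (le_trans (ler_norm_sum _ _ _)) //.
apply: ler_sum => v _; case: ifP => [_|/negbFE/asboolP good].
  rewrite -intrB -intr_norm -natr_absz -natrM ler_nat.
  have h1 := strace_norm (fun w => follow step v w == Some v) (L r).
  have h2 := strace_norm (fun w => weval gens w == 1%g) (L r).
  move: h1 h2; rewrite /tau; move: (strace _ _) (strace _ _) (snorm _) => a b c.
  by lia.
have -> : strace (fun w => follow step v w == Some v) (L r) = tau r.
  rewrite /tau /strace big_seq_cond [RHS]big_seq_cond; apply: eq_bigl => t.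
  case tL: (t \in L r) => //=; congr (_ && _).
  have le_len : (size t.2.2 <= len)%N.
    apply: (leq_bigmax_seq (F := fun t => size t.2.2)) => //.
    by rewrite mem_cat; case: rmp tL => -> ->; rewrite ?orbT.
  by apply/eqP/eqP => h; apply/(good _ le_len).
by rewrite subrr normr0.
Qed.

(** The model has dimension k |V|, so division by |V| leaves an error that depends on k and q alone.
    The sofic error is made smaller than any [e]. *)
Lemma moment_gap q m p : (0 < q)%N -> (q * C ^ q.+1 <= m)%N ->
  moment R gens A m <= moment R gens A p + k%:R * (q%:R^-1 + q.+1%:R^-1).
Proof.
move=> q_gt0 le_m.
have C_gt0 : 0 < C%:R :> R by rewrite ltr0n /C /sbound addn2.
have momentE r : moment R gens A r = (tau r)%:~R / C%:R ^+ r.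
  by rewrite /tau /L /D -moment_strace mulfK // expf_neq0 // lt0r_neq0.
rewrite !momentE; set err := k%:R * _.
pose K r : R := 2 * (snorm (L r))%:R / C%:R ^+ r.
have K_ge0 r : 0 <= K r.
  by rewrite divr_ge0 ?exprn_ge0 ?mulr_ge0 // ltW.
(* The two trace approximations err by eps |V| (K m + K p) in total, which this choice keeps below
   |V| e. *)
apply/ler_addgt0Pr => e e_gt0; pose eps := e / (K m + K p + 1).
have KK : 0 < K m + K p + 1 by rewrite ltr_wpDl // addr_ge0.
have eps_gt0 : 0 < eps by rewrite divr_gt0.
have [V [step [V_gt0 stepV approx]]] := trace_approximation m p eps_gt0.
have VR : 0 < #|V|%:R :> R by rewrite ltr0n.
pose tr r : R := (\tr (eval_mx step (L r)))%:~R / C%:R ^+ r.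
have gap : tr m <= tr p + #|{: 'I_k * V}|%:R * (q%:R^-1 + q.+1%:R^-1).
  have rowB i : (\sum_j `|((eval_mx step A)^T *m eval_mx step A) i j| <= C)%N.
    rewrite -eval_mx_sstar // -eval_mx_smul.
    apply: (@leq_trans (snorm (smul (sstar (@linv n) A) A))); last first.
      apply: leq_trans (snorm_smul _ _) _.
      by rewrite /snorm big_map /C /sbound mulnn leq_addr.
    apply: leq_trans (eval_entry_norm step _ (enum_val i)).
    rewrite [leqRHS](sum_enum_val (S := nat)).
    by apply: leq_sum => j _; rewrite mxE.
  have C_ge2 : (2 <= C)%N by rewrite /C /sbound addn2.
  (* The spectral theorem is available over an algebraically closed field; the resulting inequality
     involves only real numbers and is pulled back to [R]. *)
  have := @spectral_gap (R[i])%C _ (eval_mx step A)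
    C C_ge2 rowB q m p q_gt0 le_m.
  rewrite -!eval_mx_sdefect // -!eval_mx_spow //.
  have natC (j : nat) : j%:R = (j%:R : R)%:C%C :> R[i]%C.
    by rewrite -[RHS]/(real_complex R j%:R) rmorph_nat.
  have intC (j : int) : j%:~R = (j%:~R : R)%:C%C :> R[i]%C.
    by rewrite -[RHS]/(real_complex R j%:~R) rmorph_int.
  rewrite !natC !intC -!rmorphXn /= -!fmorphV -!rmorphM -!rmorphD -rmorphM
    -rmorphD.
  by rewrite lecR !natrX.
rewrite card_prod card_ord in gap.
have close r : r = m \/ r = p ->
    `|tr r - #|V|%:R * ((tau r)%:~R / C%:R ^+ r)| <= eps * #|V|%:R * K r.
  move=> /approx approx_r; rewrite /tr [_ * (_ / _)]mulrA -mulrBl normrM /K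
    [leRHS]mulrA.
  rewrite [X in _ * X <= _]ger0_norm ?invr_ge0 ?exprn_ge0 ?(ltW C_gt0) //.
  by rewrite ler_wpM2r // invr_ge0 exprn_ge0 // ltW.
have [cm cp] := (close m (or_introl erefl), close p (or_intror erefl)).
move: cm cp; rewrite !ler_norml => /andP[cm _] /andP[_ cp].
rewrite -(ler_pM2l VR).
have -> : #|V|%:R * ((tau p)%:~R / C%:R ^+ p + err + e) =
  #|V|%:R * ((tau p)%:~R / C%:R ^+ p) + (k * #|V|)%:R * (q%:R^-1 + q.+1%:R^-1)
    + #|V|%:R * e.
  by rewrite /err natrM; ring.
have le_e : eps * #|V|%:R * K m + eps * #|V|%:R * K p <= #|V|%:R * e.
  have -> : eps * #|V|%:R * K m + eps * #|V|%:R * K p = #|V|%:R * (eps * (K m +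
    K p)) by ring.
  rewrite ler_wpM2l // /eps mulrAC ler_pdivrMr // ler_wpM2l ?(ltW e_gt0) //.
  by rewrite lerDl.
move: gap cm cp le_e; move: (tr m) (tr p) (eps * _ * K m) (eps * _ * K p) =>
  u u' a a'.
move: (_ * (_ / _)) (_ * (_ / _)) (_ * (_^-1 + _)) (_ * e) => x y z w.
lra.
Qed.

End Gap.

Lemma kernel_testP (R : realType) (G : groupType) (kG k n : nat)
    (gens : 'I_n -> G) (M : 'M[formal n]_k) :
  sofic R G -> (0 < kG)%N -> (0 < k)%N ->
  @l2_betti_numbers R G = [set j%:R / kG%:R | j in [set: nat]]%classic ->
  kernel_test (@linv n) kG (fun w => `[< weval gens w = 1%g >]) (enum 'I_k)
    (entries M) <->
  ker_trivial R (map_mx (formal_eval gens) M).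
Proof.
move=> G_sofic kG_gt0 k_gt0 betti; rewrite ker_trivialP.
set A := entries M; set d := kdim R gens A.
pose q := sprec kG (enum 'I_k); pose C := sbound A.
pose m := sexp kG (enum 'I_k) A.
have qE : q = (2 * (k * kG)).+1 by rewrite /q /sprec size_enum_ord.
have C_gt0 : 0 < C%:R :> R by rewrite ltr0n /C /sbound addn2.
have kGR : 0 < kG%:R :> R by rewrite ltr0n.
have testE : kernel_test (@linv n) kG (fun w => `[< weval gens w = 1%g >])
    (enum 'I_k) A = (kG%:R * moment R gens A m < 1).
  rewrite /kernel_test -/m -/C.
  have -> : strace (fun w => `[< weval gens w = 1%g >])
      (spow (enum 'I_k) (sdefect (@linv n) C (enum 'I_k) A) m) =
    strace (fun w => weval gens w == 1%g)
      (spow (enum 'I_k) (sdefect (@linv n) C (enum 'I_k) A) m).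
    by apply: eq_bigl => t; congr (_ && _); apply/asboolP/eqP.
  rewrite -(ltr_int R) intrM -moment_strace -/C -!pmulrn natrX mulrA.
  by rewrite -[ltRHS]mul1r ltr_pM2r // exprn_gt0.
rewrite testE; split=> [test|d0].
  have : @l2_betti_numbers R G d.
    by exists k, (map_mx (formal_eval gens) M); split=> //;
      exact: kdim_dim_vN_ker.
  (* If d = (j + 1) / k(G), then k(G) a_m >= k(G) d >= 1, against the test. *)
  rewrite betti => -[[|j] _ dE]; first by rewrite -dE mul0r.
  have := kdim_le_moment R gens A m; rewrite -/d -dE.
  rewrite ler_pdivrMr // mulrC => /le_lt_trans/(_ test).
  by rewrite ltrn1.
have q_gt0 : (0 < q)%N by rewrite qE.
have := moment_le_kdim (R := R) (gens := gens) (A := A) (m := m)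
  (delta := k%:R * (q%:R^-1 + q.+1%:R^-1)) (fun p _ =>
    moment_gap gens G_sofic p q_gt0 (leqnn _)).
rewrite -/d d0 add0r => le_m.
apply: (le_lt_trans (ler_wpM2l (ltW kGR) le_m)).
have qR : 0 < q%:R :> R by rewrite ltr0n.
have lt1 : q.+1%:R^-1 <= q%:R^-1 :> R.
  by rewrite lef_pV2 ?posrE ?ltr0n // ler_nat.
(* Both fractions in the error are at most 1/q, so k(G) a_m <= 2 k(G) k / q; the value of [q] is the
   least integer that makes this less than 1. *)
have kGk : 2 * (kG%:R * k%:R) < q%:R :> R.
  by rewrite -!natrM ltr_nat qE mulnC (mulnC kG) mulnC.
rewrite mulrA; apply: (@le_lt_trans _ _ (kG%:R * k%:R * (2 * q%:R^-1))).
  by rewrite ler_wpM2l ?mulr_ge0 // mulr_natl mulr2n lerD2l.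
by rewrite mulrA (mulrC _ 2) ltr_pdivrMr // mul1r.
Qed.

Theorem proposition3 (R : realType) (G : groupType)
  (G_fp : finitely_presented G)
  (G_sofic : sofic R G)
  (G_BFS : BFS_group G)
  (G_wp : decidable_word_problem G)
  (G_atiyah : Atiyah_conjecture R G) :
  kernel_over_ZG_solvable R G.
Proof.
move=> n gens _; have [kG [kG_gt0 betti]] := G_atiyah.
have [f fP] := kernel_test_algorithm gens kG G_wp.
exists f => k M k_gt0; exists (kernel_test (@linv n) kG
  (fun w => `[< weval gens w = 1%g >]) (enum 'I_k) (entries M)).
split; first exact: fP.
exact: kernel_testP.
Qed.
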